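(* Let $k$ be an algebraically closed field of characteristic $p>2$, let $\mathbb T$ be an algebraic torus over $k$, and let $\sigma$ be a Poisson $\mathbb T$-Pfaffian of a (non-singular) $\mathbb T$-Poisson variety $(X,\pi_X)$ over $k$. If the Frobenius near-splitting $\phi_\sigma$ defined by $\sigma$ is a Frobenius splitting, then all compatibly split subvarieties of $\phi_\sigma$ are $\mathbb T$-Poisson subvarieties with respect to the Poisson structure $\pi_X$.
   Context: A Poisson structure on a non-singular variety $X$ over $k$ is $\pi\in H^0(X,\wedge^2\mathcal T_X)$ with $[\pi,\pi]=0$ (Schouten bracket). A $\mathbb T$-Poisson variety is a non-singular variety with a Poisson structure and a $\mathbb T$-action by Poisson automorphisms. $\mathfrak t=\mathrm{Lie}(\mathbb T)$; for $h\in\mathfrak t$, $\partial_h$ is the vector field on $X$ generated by $h$ (on a local $\mathbb T$-weight function $a$ of weight $\lambda$, $\partial_h(a)=\lambda(h)a$, where $\lambda$ also denotes the differential of the character). For $r\ge1$, $\pi^{[r]}$ is defined by $\pi^{[r]}(a_1,\dots,a_{2r})=\sum_{\sigma}\mathrm{sgn}(\sigma)\,\pi(a_{\sigma(1)},a_{\sigma(2)})\cdots\pi(a_{\sigma(2r-1)},a_{\sigma(2r)})$, the sum over $\sigma\in S_{2r}$ with $\sigma(1)<\sigma(3)<\cdots<\sigma(2r-1)$ and $\sigma(2i-1)<\sigma(2i)$ for all $i$; $\pi^{[0]}=1$. The rank of $\pi$ is $2r$ with $r$ largest such that $\pi^{[r]}\ne0$. A Poisson $\mathbb T$-Pfaffian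 is a non-zero $\sigma\in H^0(X,\omega_X^{-1})$ of the form $\sigma=\pi^{[r]}\wedge\partial_{h_1}\wedge\cdots\wedge\partial_{h_l}$, $2r=\mathrm{rank}(\pi)$, $h_1,\dots,h_l\in\mathfrak t$. Let $F$ be the absolute Frobenius of $X$. A Frobenius near-splitting is an $\mathcal O_X$-linear map $\varphi:F_*\mathcal O_X\to\mathcal O_X$; it is a Frobenius splitting if $\varphi\circ F^\sharp=\mathrm{id}$, where $F^\sharp:\mathcal O_X\to F_*\mathcal O_X$. The near-splitting $\phi_\sigma$ defined by $\sigma\in H^0(X,\omega_X^{-1})$ is given by $\phi_\sigma(f)\gamma=C\bigl(f\,(\sigma^{p-1},\gamma^{p-1})\,\gamma\bigr)$ for $\gamma$ a local generator of $\omega_X$, where $C:F_*\omega_X\to\omega_X$ is the Cartier operator. A closed subvariety $Y\subset X$ with ideal sheaf $\mathcal I_Y$ is compatibly split by a splitting $\varphi$ if $\varphi(F_*\mathcal I_Y)\subset\mathcal I_Y$. A closed subvariety $Y$ is a $\mathbb T$-Poisson subvariety if its ideal sheaf is stable under all local Hamiltonian vector fields $X_a=\{a,-\}$ and under all vector fields $\partial_h$, $h\in\mathfrak t$. *)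

(* Defs.v *)
From HB Require Import structures.
From mathcomp Require Import all_boot all_order all_algebra all_fingroup.
From mathcomp Require Import mpoly.
From mathcomp Require Import boolp classical_sets functions filter.
From mathcomp Require Import topology_structure.

Set Implicit Arguments.
Unset Strict Implicit.
Unset Printing Implicit Defensive.

Import GRing.Theory.
Local Open Scope classical_set_scope.
Local Open Scope ring_scope.

(* Varieties over an algebraically closed field [k] are spaces with           *)
(* functions (J.-P. Serre, FAC): the points are the closed points, with the   *)
(* Zariski topology, and the structure sheaf is a sheaf of [k]-valued         *)
(* functions.  [regular f x] means that the germ at [x] of [f] belongs to the *)
(* local ring at [x].  A section of the structure sheaf over an open set [U]  *)
(* is represented by any function on the whole of [X] which is regular at the *)
(* points of [U]; its values outside [U] are junk.                            *)

Record kspace (k : closedFieldType) := KSpace {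
  points :> topologicalType;
  regular : (points -> k) -> points -> Prop }.

Definition regular_on (k : closedFieldType) (X : kspace k) (U : set X)
  (f : X -> k) : Prop := forall x, U x -> regular f x.

Section Varieties.
Variable k : closedFieldType.

(* [c] identifies the open set [U] with the locally closed set [Z] of affine  *)
(* [N]-space, with its Zariski topology and its sheaf of regular functions.   *)
Definition is_chart (X : kspace k) (N : nat) (U : set X)
    (c : 'I_N -> X -> k) (Z : set ('I_N -> k)) : Prop :=
  let c_ (x : X) := fun i => c i x in
  [/\ open U,
      forall x, U x -> Z (c_ x),
      forall v, Z v -> exists! x, U x /\ c_ x = v,
      forall x (V : set X), U x ->
        (nbhs x V <-> exists q : {mpoly k[N]}, q.@[c_ x] != 0 /\
           forall y, U y -> q.@[c_ y] != 0 -> V y) &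
      forall x (f : X -> k), U x ->
        (regular f x <-> exists q r : {mpoly k[N]}, r.@[c_ x] != 0 /\
           \forall y \near x, f y = q.@[c_ y] / r.@[c_ y])].

Definition is_affine (X : kspace k) (U : set X) : Prop :=
  exists (N : nat) (c : 'I_N -> X -> k) (Q : set {mpoly k[N]}),
    is_chart U c [set v | forall q, Q q -> q.@[v] = 0].

Section Products.
Variables X Y : kspace k.

(* near (x, y), h is a section of the tensor product of the sheaves *)
Definition tensor (h : X -> Y -> k) (x : X) (y : Y) : Prop :=
  exists (M : nat) (u : 'I_M -> X -> k) (v : 'I_M -> Y -> k),
    (forall i, regular (u i) x /\ regular (v i) y) /\
    \forall x' \near x & y' \near y, h x' y' = \sum_(i < M) u i x' * v i y'.

(* The Zariski topology of X * Y (finer than the product topology) and its    *)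
(* regular functions.                                                         *)
Definition prod_near (x : X) (y : Y) (W : X -> Y -> Prop) : Prop :=
  exists h, [/\ tensor h x y, h x y != 0 &
    \forall x' \near x & y' \near y, h x' y' != 0 -> W x' y'].

Definition prod_regular (F : X -> Y -> k) (x : X) (y : Y) : Prop :=
  exists g h, [/\ tensor g x y, tensor h x y, h x y != 0 &
    prod_near x y (fun x' y' => F x' y' = g x' y' / h x' y')].

Definition prod_morphism (Z : kspace k) (F : X -> Y -> Z) : Prop :=
  forall x y,
    (forall W, nbhs (F x y) W -> prod_near x y (fun x' y' => W (F x' y'))) /\
    (forall f, regular f (F x y) ->
       prod_regular (fun x' y' => f (F x' y')) x y).

End Products.

Definition is_separated (X : kspace k) : Prop :=
  forall x y : X, x <> y -> prod_near x y (fun x' y' => x' <> y').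

Definition is_variety (X : kspace k) : Prop :=
  is_separated X /\
  exists (M : nat) (U : 'I_M -> set X),
    (forall i, is_affine (U i)) /\ (forall x, exists i, U i x).

Definition is_irreducible (X : topologicalType) (Z : set X) : Prop :=
  Z !=set0 /\ forall A B, closed A -> closed B ->
    Z `<=` A `|` B -> Z `<=` A \/ Z `<=` B.

(* chain of length d of irreducible closed subsets through x *)
Definition is_chain (X : topologicalType) (x : X) (d : nat)
    (Z : nat -> set X) : Prop :=
  (forall i, (i <= d)%N -> [/\ closed (Z i), is_irreducible (Z i) & Z i x]) /\
  (forall i, (i < d)%N -> Z i `<` Z i.+1).

(* The Krull dimension of the local ring at x is d. *)
Definition local_dim (X : topologicalType) (x : X) (d : nat) : Prop :=
  (exists Z, is_chain x d Z) /\
  (forall d' Z, is_chain x d' Z -> (d' <= d)%N).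

Definition in_max (X : kspace k) (x : X) (f : X -> k) : Prop :=
  regular f x /\ f x = 0.

Definition in_max2 (X : kspace k) (x : X) (f : X -> k) : Prop :=
  exists (M : nat) (u v : 'I_M -> X -> k),
    (forall i, in_max x (u i) /\ in_max x (v i)) /\
    \forall y \near x, f y = \sum_(i < M) u i y * v i y.

(* The cotangent space m_x / m_x^2 has a basis of d elements. *)
Definition cotangent_dim (X : kspace k) (x : X) (d : nat) : Prop :=
  exists t : 'I_d -> X -> k, (forall i, in_max x (t i)) /\
    forall f, in_max x f -> exists! c : 'rV[k]_d,
      in_max2 x (fun y => f y - \sum_(i < d) c 0 i * t i y).

(* All local rings are regular, of the same dimension n. *)
Definition is_nonsingular (X : kspace k) (n : nat) : Prop :=
  forall x : X, local_dim x n /\ cotangent_dim x n.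

End Varieties.

Section PolyvectorFields.
Variables (k : closedFieldType) (X : kspace k).

(* On a non-singular variety a section of the m-th exterior power of the      *)
(* tangent sheaf is an alternating m-derivation of the structure sheaf, the   *)
(* decomposable section v_1 ^ ... ^ v_m being the m-derivation                *)
(* a |-> det (v_i a_j).  Such a section over [U] is represented by an operator*)
(* on arbitrary functions, which is meaningful only at the points of [U] where*)
(* the arguments are regular.                                                 *)
Definition op (m : nat) := ('I_m -> X -> k) -> X -> k.

Definition polyvector (m : nat) (U : set X) (P : op m) : Prop :=
  forall x, U x -> forall a : 'I_m -> X -> k, (forall i, regular (a i) x) ->
  [/\ regular (P a) x,
      (forall b, (forall i, \forall y \near x, a i y = b i y) ->
         P a x = P b x),
      (forall i j, i != j -> a i = a j -> P a x = 0),
      (forall i f g (c : k), regular f x -> regular g x ->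
         P [eta a with i |-> fun y => c * f y + g y] x =
         c * P [eta a with i |-> f] x + P [eta a with i |-> g] x) &
      (forall i f g, regular f x -> regular g x ->
         P [eta a with i |-> fun y => f y * g y] x =
         f x * P [eta a with i |-> g] x + g x * P [eta a with i |-> f] x)].

Definition polyvector_eq (m : nat) (U : set X) (P Q : op m) : Prop :=
  forall x, U x -> forall a : 'I_m -> X -> k, (forall i, regular (a i) x) ->
    P a x = Q a x.

Definition zero_op (m : nat) : op m := fun _ _ => 0.
Arguments zero_op : clear implicits.

(* exterior product of multiderivations: sum over the (p, q)-shuffles s *)
Definition polywedge (p q : nat) (P : op p) (Q : op q) : op (p + q) :=
  fun a x =>
    \sum_(s : 'S_(p + q) |
        [forall i : 'I_p, forall j : 'I_p,
           (i < j)%N ==> (s (lshift q i) < s (lshift q j))%N] &&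
        [forall i : 'I_q, forall j : 'I_q,
           (i < j)%N ==> (s (rshift p i) < s (rshift p j))%N])
      (-1) ^+ s * P (fun i => a (s (lshift q i))) x *
      Q (fun j => a (s (rshift p j))) x.

(* v_1 ^ ... ^ v_l for vector fields v_i *)
Definition wedge_fields (l : nat) (v : 'I_l -> (X -> k) -> X -> k) : op l :=
  fun a x => \det (\matrix_(i < l, j < l) v i (a j) x).

Definition bracket (pi : op 2) (a b : X -> k) : X -> k :=
  pi (fun i : 'I_2 => if i == ord0 then a else b).

(* Schouten bracket of two bivector fields *)
Definition schouten (pi rho : op 2) : op 3 := fun a x =>
  let J u v w := bracket pi (bracket rho u v) w x
                 + bracket rho (bracket pi u v) w x in
  let a0 := a (inord 0) in let a1 := a (inord 1) in let a2 := a (inord 2) in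
  J a0 a1 a2 + J a1 a2 a0 + J a2 a0 a1.

Definition is_poisson (pi : op 2) : Prop :=
  polyvector setT pi /\ polyvector_eq setT (schouten pi pi) (zero_op 3).

Fact pair_ord_subproof (r : nat) (b : bool) (i : 'I_r) : (b + i.*2 < r.*2)%N.
Proof. by case: b; rewrite ?add1n ?add0n ?ltn_Sdouble ?ltn_double. Qed.

(* the positions 2 i (b = false) and 2 i + 1 (b = true), counted from 0 *)
Definition pair_ord (r : nat) (b : bool) (i : 'I_r) : 'I_(r.*2) :=
  Ordinal (pair_ord_subproof b i).

(* pi^[r], the r-th divided power of pi; pi^[0] = 1 *)
Definition div_pow (pi : op 2) (r : nat) : op r.*2 :=
  fun a x =>
    \sum_(s : 'S_(r.*2) |
        [forall i : 'I_r, forall j : 'I_r, (i < j)%N ==>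
           (s (pair_ord false i) < s (pair_ord false j))%N] &&
        [forall i : 'I_r, (s (pair_ord false i) < s (pair_ord true i))%N])
      (-1) ^+ s * \prod_(i < r)
        bracket pi (a (s (pair_ord false i))) (a (s (pair_ord true i))) x.

Arguments div_pow : clear implicits.

(* the rank of pi is 2 r *)
Definition half_rank (pi : op 2) (r : nat) : Prop :=
  ~ polyvector_eq setT (div_pow pi r) (zero_op r.*2) /\
  forall r', ~ polyvector_eq setT (div_pow pi r') (zero_op r'.*2) ->
    (r' <= r)%N.

End PolyvectorFields.

Arguments div_pow {k X} pi r.
Arguments zero_op {k X} m.

Section TorusActions.
Variables (k : closedFieldType) (T : kspace k) (m : nat) (chi : 'I_m -> T -> k).

(* [chi] identifies T with the torus G_m^m, for which the group law is the    *)
(* coordinatewise product and the Lie algebra is k^m.                         *)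
Definition is_torus : Prop := is_chart setT chi [set v | forall i, v i != 0].

Definition torus_action (X : kspace k) (act : T -> X -> X) : Prop :=
  [/\ prod_morphism act,
      (forall e x, (forall i, chi i e = 1) -> act e x = x) &
      (forall s t u x, (forall i, chi i u = chi i s * chi i t) ->
         act u x = act s (act t x))].

Definition acts_by_poisson (X : kspace k) (act : T -> X -> X) (pi : op X 2)
    : Prop :=
  forall t x (a b : X -> k), regular a (act t x) -> regular b (act t x) ->
    bracket pi (fun y => a (act t y)) (fun y => b (act t y)) x =
    bracket pi a b (act t x).

(* The vector field generated by h in Lie(T) = k^m: the value at x of its     *)
(* action on a is the derivative at s = 0 of s |-> a (t(s) x), where          *)
(* t(s) = 1 + s h is a curve in T with tangent vector h at 1.  That function  *)
(* of s is a quotient q / r of polynomials on a neighbourhood of 0.  Thus, if *)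
(* a (t x) = lambda(t) a x for a character lambda of T, then a is mapped to   *)
(* lambda(h) a.                                                               *)
Definition gen_field (X : kspace k) (act : T -> X -> X) (h : 'I_m -> k)
    (a : X -> k) (x : X) : k :=
  xget 0 [set d | exists q r : {poly k},
    [/\ r.[0] != 0,
        (forall (s : k) (t : T), (forall i, chi i t = 1 + s * h i) ->
           r.[s] != 0 -> a (act t x) = q.[s] / r.[s]) &
        d = (q^`() * r - q * r^`()).[0] / r.[0] ^+ 2]].

Definition is_pfaffian (X : kspace k) (n : nat) (act : T -> X -> X)
    (pi : op X 2) (sigma : op X n) : Prop :=
  [/\ polyvector setT sigma,
      ~ polyvector_eq setT sigma (zero_op n) &
      exists (r l : nat) (h : 'I_l -> 'I_m -> k) (E : (r.*2 + l)%N = n),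
        half_rank pi r /\
        polyvector_eq setT sigma (fun a =>
          polywedge (div_pow pi r)
            (wedge_fields (fun i => gen_field act (h i)))
            (fun j => a (cast_ord E j)))].

End TorusActions.

Section Forms.
Variables (k : closedFieldType) (X : kspace k) (n : nat).

(* Differential n-forms on a non-singular variety, as linear functionals on   *)
(* n-vector fields, that is, through the perfect pairing of the n-th exterior *)
(* powers of the cotangent and tangent sheaves for which                      *)
(* (v_1 ^ ... ^ v_n, da_1 ^ ... ^ da_n) = det (v_i a_j).  When n = dim X, a   *)
(* section gamma of omega_X and a section sigma of its dual pair to           *)
(* [gamma sigma].                                                             *)
Definition diff_form := op X n -> X -> k.

Definition form_eq (U : set X) (eta eta' : diff_form) : Prop :=
  forall x, U x -> forall (V : set X) (P : op X n), open V -> V x ->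
    polyvector V P -> eta P x = eta' P x.

(* da_1 ^ ... ^ da_n *)
Definition dwedge (a : 'I_n -> X -> k) : diff_form := fun P => P a.

Definition form_add (eta eta' : diff_form) : diff_form :=
  fun P x => eta P x + eta' P x.

Definition form_scale (f : X -> k) (eta : diff_form) : diff_form :=
  fun P x => f x * eta P x.

Definition is_form (U : set X) (eta : diff_form) : Prop :=
  forall x, U x -> exists (V : set X) (M : nat)
      (f : 'I_M -> X -> k) (a : 'I_M -> 'I_n -> X -> k),
    [/\ open V, V x,
        (forall i, regular_on V (f i) /\ forall j, regular_on V (a i j)) &
        form_eq V eta
          (fun P y => \sum_(i < M) form_scale (f i) (dwedge (a i)) P y)].

(* local generator over U of the sheaf of n-forms *)
Definition generates (U : set X) (gamma : diff_form) : Prop :=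
  is_form U gamma /\
  forall V eta, open V -> V `<=` U -> is_form V eta ->
    exists2 g, regular_on V g & form_eq V eta (form_scale g gamma).

(* C is the Cartier operator F_* omega_X -> omega_X, where n = dim X: it is   *)
(* additive and p^-1-linear, vanishes on exact forms, and induces the inverse *)
(* of the Cartier isomorphism                                                 *)
(*   f da_1 ^ ... ^ da_n |-> class of f^p (a_1 ... a_n)^(p-1) da_1 ^ ... ^ da_n*)
(* These conditions determine C.  Locally, exact n-forms (n > 0) are the sums *)
(* of forms d (a_1 da_2 ^ ... ^ da_n) = da_1 ^ ... ^ da_n.                    *)
Definition is_cartier (p : nat) (C : diff_form -> diff_form) : Prop :=
  forall U : set X, open U ->
  [/\ (forall eta, is_form U eta -> is_form U (C eta)),
      (forall eta eta', is_form U eta -> is_form U eta' ->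
         form_eq U eta eta' -> form_eq U (C eta) (C eta')),
      (forall f eta eta', regular_on U f -> is_form U eta -> is_form U eta' ->
         form_eq U (C (form_add (form_scale (fun x => f x ^+ p) eta) eta'))
                   (form_add (form_scale f (C eta)) (C eta'))),
      (forall a, (0 < n)%N -> (forall i, regular_on U (a i)) ->
         form_eq U (C (dwedge a)) (fun _ _ => 0)) &
      (forall a, (forall i, regular_on U (a i)) ->
         form_eq U
           (C (form_scale (fun x => \prod_(i < n) a i x ^+ p.-1) (dwedge a)))
           (dwedge a))].

End Forms.

Section FrobeniusSplittings.
Variables (k : closedFieldType) (X : kspace k) (p : nat).

(* an O_X-linear map phi : F_* O_X -> O_X *)
Definition near_splitting (phi : (X -> k) -> X -> k) : Prop :=
  forall U : set X, open U ->
  [/\ (forall f, regular_on U f -> regular_on U (phi f)),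
      (forall f g, regular_on U f -> (forall x, U x -> f x = g x) ->
         forall x, U x -> phi f x = phi g x) &
      (forall f g h, regular_on U f -> regular_on U g -> regular_on U h ->
         forall x, U x ->
           phi (fun y => f y ^+ p * g y + h y) x = f x * phi g x + phi h x)].

Definition is_splitting (phi : (X -> k) -> X -> k) : Prop :=
  near_splitting phi /\
  forall (U : set X) f, open U -> regular_on U f ->
    forall x, U x -> phi (fun y => f y ^+ p) x = f x.

(* phi is the near-splitting phi_sigma, for the Cartier operator C *)
Definition defined_by (n : nat) (C : diff_form X n -> diff_form X n)
    (sigma : op X n) (phi : (X -> k) -> X -> k) : Prop :=
  near_splitting phi /\
  forall (U : set X) (gamma : diff_form X n) f,
    open U -> generates U gamma -> regular_on U f ->
    form_eq U (form_scale (phi f) gamma)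
      (C (form_scale (fun x => f x * gamma sigma x ^+ p.-1) gamma)).

(* sections over U of the ideal sheaf of the reduced closed subscheme Y *)
Definition ideal_of (Y U : set X) (f : X -> k) : Prop :=
  regular_on U f /\ forall x, U x -> Y x -> f x = 0.

Definition compatibly_split (phi : (X -> k) -> X -> k) (Y : set X) : Prop :=
  forall U f, open U -> ideal_of Y U f -> ideal_of Y U (phi f).

End FrobeniusSplittings.

Definition poisson_torus_subvariety (k : closedFieldType) (X T : kspace k)
    (m : nat) (chi : 'I_m -> T -> k) (act : T -> X -> X) (pi : op X 2)
    (Y : set X) : Prop :=
  [/\ closed Y,
      (forall U a f, open U -> regular_on U a -> ideal_of Y U f ->
         ideal_of Y U (bracket pi a f)) &
      (forall (h : 'I_m -> k) U f, open U -> ideal_of Y U f ->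
         ideal_of Y U (gen_field chi act h f))].

(* Main.v *)
Require Import Defs.
From mathcomp Require Import all_boot all_order all_algebra all_fingroup.
From mathcomp Require Import mpoly.
From mathcomp Require Import boolp classical_sets functions filter.
From mathcomp Require Import topology_structure.
From mathcomp Require Import ring.

(* Let D be a vector field with L_D sigma = 0.  In local coordinates t, with
   s = sigma t, Cartan's formula shows that D g s^(p-1) dt_1 ... dt_n is exact,
   so that phi (D g) = 0 for every g.  If f vanishes on Y and w = D f, then
   w = phi (w^p) = phi (D (w^(p-1) f)) - phi (f D (w^(p-1))), whose first term is
   0 and whose second term vanishes on Y, because phi preserves the ideal of Y.
   Hence the ideal of Y is stable under D.

   This applies to the generators of the torus action, which commute with each
   other and preserve pi, and to a Hamiltonian field X_a: L_(X_a) pi = 0 by the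
   Jacobi identity, [X_a, d_h] is the Hamiltonian field of - d_h a, and
   pi^[r] ^ X_b = 0 for every b because pi has rank 2 r. *)

Set Implicit Arguments.
Unset Strict Implicit.
Unset Printing Implicit Defensive.

Import GRing.Theory.
Local Open Scope classical_set_scope.
Local Open Scope ring_scope.

(** * Regular functions *)

(** Everything is verified at one point at a time. [L_D sigma] is again a multiderivation, so its
    vanishing at [y] may be tested on any functions whose differentials form a basis at [y].
    Combinations of local coordinates with constant coefficients suffice to put [pi] in normal form
    at that single point, where its rank may be smaller than [2 r]. The characteristic enters
    through [p - 1 = -1] in [k], which makes the divergence of [D] cancel, and through the
    invertibility of 2, which gives the Jacobi identity from [[pi, pi] = 0] and a zero diagonal for
    antisymmetric matrices. The longest detour concerns the torus. Its generators are defined point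
    by point, as derivatives along one curve of [T], so that even their regularity has to be proved.
    As the action is a morphism, [f (act t z)] is locally a quotient of finite sums of products of a
    function of [t] and a function of [z]. Along the curve, after clearing denominators, these sums
    are polynomials in [s] whose coefficients are regular functions of [z], and differentiation in
    [s] then commutes with derivations in [z]. *)

Definition has_charts (k : closedFieldType) (X : kspace k) : Prop :=
  forall x : X, exists (N : nat) (U : set X) (c : 'I_N -> X -> k) Z,
    is_chart U c Z /\ U x.

Section RegularFunctions.
Variables (k : closedFieldType) (X : kspace k).
Hypothesis X_charts : has_charts X.
Implicit Types (x : X) (f g : X -> k).

Lemma chart_regular N (U : set X) (c : 'I_N -> X -> k) Z x f :
  is_chart U c Z -> U x -> regular f x <->
  exists q r : {mpoly k[N]}, r.@[c^~ x] != 0 /\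
    \forall y \near x, f y = q.@[c^~ y] / r.@[c^~ y].
Proof. by case=> _ _ _ _ H Ux; apply: H. Qed.

Lemma chart_near N (U : set X) (c : 'I_N -> X -> k) Z x (r : {mpoly k[N]}) :
  is_chart U c Z -> U x -> r.@[c^~ x] != 0 ->
  \forall y \near x, U y /\ r.@[c^~ y] != 0.
Proof.
case=> oU _ _ H _ Ux rx; near=> y; split; near: y.
  exact: open_nbhs_nbhs.
by apply/(H _ _ Ux); exists r; split => // y.
Unshelve. all: by end_near. Qed.

Lemma near_regular x f : regular f x -> \forall y \near x, regular f y.
Proof.
have [N [U [c [Z [cU Ux]]]]] := X_charts x.
move/(chart_regular _ cU Ux) => [q [r [rx E]]].
(* The fraction that represents [f] near [x] does so near every point close to [x]. *)
have /= E' := nbhs_interior E.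
have R := chart_near cU Ux rx.
near=> y; have [Uy ry] : U y /\ r.@[c^~ y] != 0 by near: y.
by apply/(chart_regular _ cU Uy); exists q, r; split => //; near: y.
Unshelve. all: by end_near. Qed.

Lemma regular_local x f g :
  (\forall y \near x, f y = g y) -> regular f x -> regular g x.
Proof.
have [N [U [c [Z [cU Ux]]]]] := X_charts x.
move=> fg /(chart_regular _ cU Ux) [q [r [rx E]]].
apply/(chart_regular _ cU Ux); exists q, r; split=> //.
by near=> y; rewrite -(near fg y) //; near: y.
Unshelve. all: by end_near. Qed.

Lemma regular_cst x (a : k) : regular (fun=> a) x.
Proof.
have [N [U [c [Z [cU Ux]]]]] := X_charts x.
apply/(chart_regular _ cU Ux); exists a%:MP, 1; rewrite rmorph1 oner_neq0.
by split=> //; near=> y; rewrite rmorph1 divr1 mevalC.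
Unshelve. all: by end_near. Qed.

Lemma regular_add x f g :
  regular f x -> regular g x -> regular (fun y => f y + g y) x.
Proof.
have [N [U [c [Z [cU Ux]]]]] := X_charts x.
move=> /(chart_regular _ cU Ux) [q [r [rx E]]].
move=> /(chart_regular _ cU Ux) [q' [r' [rx' E']]].
apply/(chart_regular _ cU Ux); exists (q * r' + q' * r), (r * r').
rewrite rmorphM mulf_neq0 //; split=> //.
have R := chart_near cU Ux rx; have R' := chart_near cU Ux rx'.
near=> y.
have [_ ry] : U y /\ r.@[c^~ y] != 0 by near: y.
have [_ ry'] : U y /\ r'.@[c^~ y] != 0 by near: y.
rewrite (near E y) // (near E' y) // !rmorphD !rmorphM /=; field.
by rewrite ry ry'.
Unshelve. all: by end_near. Qed.

Lemma regular_mul x f g :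
  regular f x -> regular g x -> regular (fun y => f y * g y) x.
Proof.
have [N [U [c [Z [cU Ux]]]]] := X_charts x.
move=> /(chart_regular _ cU Ux) [q [r [rx E]]].
move=> /(chart_regular _ cU Ux) [q' [r' [rx' E']]].
apply/(chart_regular _ cU Ux); exists (q * q'), (r * r').
rewrite rmorphM mulf_neq0 //; split=> //.
near=> y; rewrite (near E y) // (near E' y) // !rmorphM /=.
by rewrite invfM mulrACA.
Unshelve. all: by end_near. Qed.

Lemma regular_inv x f : f x != 0 -> regular f x -> regular (fun y => (f y)^-1) x.
Proof.
have [N [U [c [Z [cU Ux]]]]] := X_charts x.
move=> fx /(chart_regular _ cU Ux) [q [r [rx E]]].
apply/(chart_regular _ cU Ux); exists r, q; split.
  apply: contraNneq fx; rewrite (nbhs_singleton E) => ->.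
  by rewrite mul0r.
by near=> y; rewrite (near E y) // invf_div.
Unshelve. all: by end_near. Qed.

Lemma near_neq0 x f : regular f x -> f x != 0 -> \forall y \near x, f y != 0.
Proof.
have [N [U [c [Z [cU Ux]]]]] := X_charts x.
move=> /(chart_regular _ cU Ux) [q [r [rx E]]] fx.
have qx : q.@[c^~ x] != 0.
  apply: contraNneq fx; rewrite (nbhs_singleton E) => ->.
  by rewrite mul0r.
have Q := chart_near cU Ux qx; have R := chart_near cU Ux rx.
near=> y; rewrite (near E y) //.
have [_ ry] : U y /\ r.@[c^~ y] != 0 by near: y.
have [_ qy] : U y /\ q.@[c^~ y] != 0 by near: y.
by rewrite mulf_neq0 ?invr_eq0.
Unshelve. all: by end_near. Qed.

Lemma regular_opp x f : regular f x -> regular (fun y => - f y) x.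
Proof.
move=> rf; have := regular_mul (regular_cst x (-1)) rf.
by congr (regular _ x); apply: funext => y; rewrite mulN1r.
Qed.

Lemma regular_sub x f g :
  regular f x -> regular g x -> regular (fun y => f y - g y) x.
Proof. by move=> rf rg; apply: regular_add rf (regular_opp rg). Qed.

Lemma regular_sum x (I : Type) (s : seq I) (P : pred I) (F : I -> X -> k) :
  (forall i, P i -> regular (F i) x) ->
  regular (fun y => \sum_(i <- s | P i) F i y) x.
Proof.
move=> rF; elim: s => [|i s IHs].
  have := regular_cst x 0; congr (regular _ x).
  by apply: funext => y; rewrite big_nil.
have [Pi|nPi] := boolP (P i); last first.
  move: IHs; congr (regular _ x).
  by apply: funext => y; rewrite big_cons (negPf nPi).
have := regular_add (rF i Pi) IHs; congr (regular _ x).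
by apply: funext => y; rewrite big_cons Pi.
Qed.

Lemma regular_prod x (I : Type) (s : seq I) (P : pred I) (F : I -> X -> k) :
  (forall i, P i -> regular (F i) x) ->
  regular (fun y => \prod_(i <- s | P i) F i y) x.
Proof.
move=> rF; elim: s => [|i s IHs].
  have := regular_cst x 1; congr (regular _ x).
  by apply: funext => y; rewrite big_nil.
have [Pi|nPi] := boolP (P i); last first.
  move: IHs; congr (regular _ x).
  by apply: funext => y; rewrite big_cons (negPf nPi).
have := regular_mul (rF i Pi) IHs; congr (regular _ x).
by apply: funext => y; rewrite big_cons Pi.
Qed.

Lemma regular_exp x f n : regular f x -> regular (fun y => f y ^+ n) x.
Proof.
move=> rf; have := @regular_prod x _ (index_enum 'I_n) xpredT (fun=> f)
  (fun _ _ => rf); congr (regular _ x).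
by apply: funext => y; rewrite prodr_const card_ord.
Qed.

Lemma regular_det x n (M : X -> 'M[k]_n) :
  (forall i j, regular (fun y => M y i j) x) -> regular (fun y => \det (M y)) x.
Proof.
move=> rM; apply: regular_sum => s _; apply: regular_mul.
  exact: regular_cst.
by apply: regular_prod => i _; apply: rM.
Qed.

Lemma regular_adj x n (M : X -> 'M[k]_n) i j :
  (forall i j, regular (fun y => M y i j) x) ->
  regular (fun y => (\adj (M y)) i j) x.
Proof.
move=> rM; under [X in regular X]funext => y do rewrite mxE /cofactor.
apply: regular_mul; first exact: regular_cst.
apply: regular_det => a b.
by under [X in regular X]funext => y do rewrite !mxE; apply: rM.
Qed.

End RegularFunctions.

(** * Point derivations and differentials *)

Section PointDerivations.
Variables (k : closedFieldType) (X : kspace k).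
Hypothesis X_charts : has_charts X.
Implicit Types (x : X) (f g : X -> k) (v : (X -> k) -> k).

(** Tangent vectors at [x]. Germs are represented by functions on all of [X], so the first clause
    has to state that only the germ at [x] counts. *)
Definition pder x v : Prop :=
  [/\ (forall f g, regular f x -> (\forall y \near x, f y = g y) -> v f = v g),
      (forall c f g, regular f x -> regular g x ->
         v (fun y => c * f y + g y) = c * v f + v g) &
      (forall f g, regular f x -> regular g x ->
         v (fun y => f y * g y) = f x * v g + g x * v f)].

Section OneDerivation.
Variables (x : X) (v : (X -> k) -> k).
Hypothesis pv : pder x v.

Lemma pder_local f g :
  regular f x -> (\forall y \near x, f y = g y) -> v f = v g.
Proof. by case: pv => H _ _; apply: H. Qed.

Lemma pderM f g : regular f x -> regular g x ->
  v (fun y => f y * g y) = f x * v g + g x * v f.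
Proof. by case: pv => _ _; apply. Qed.

Lemma pder_lin c f g : regular f x -> regular g x ->
  v (fun y => c * f y + g y) = c * v f + v g.
Proof. by case: pv => _ H _; apply: H. Qed.

Lemma pderD f g : regular f x -> regular g x ->
  v (fun y => f y + g y) = v f + v g.
Proof.
case: pv => _ H _ rf rg; rewrite -[v f]mul1r -H //.
by congr v; apply: funext => y; rewrite mul1r.
Qed.

Lemma pder_cst a : v (fun=> a) = 0.
Proof.
have r1 := regular_cst X_charts x 1; have r0 := regular_cst X_charts x 0.
have v1 : v (fun=> 1) = 0.
  have := pderM r1 r1; rewrite !mul1r => /eqP.
  by rewrite -subr_eq0 opprD addNKr oppr_eq0 => /eqP.
have v0 : v (fun=> 0) = 0.
  by have := pderM r0 r0; rewrite !mul0r addr0.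
case: pv => _ H _; have := H a _ _ r1 r0; by rewrite v1 v0 mulr0 !addr0 mulr1.
Qed.

Lemma pderZ a f : regular f x -> v (fun y => a * f y) = a * v f.
Proof.
by move=> rf; rewrite pderM ?pder_cst ?mulr0 ?addr0 //; apply: regular_cst.
Qed.

Lemma pderN f : regular f x -> v (fun y => - f y) = - v f.
Proof.
move=> rf; rewrite -mulN1r -pderZ //.
by congr v; apply: funext => y; rewrite mulN1r.
Qed.

Lemma pderB f g : regular f x -> regular g x ->
  v (fun y => f y - g y) = v f - v g.
Proof.
by move=> rf rg; rewrite pderD ?pderN //; apply: (regular_opp X_charts).
Qed.

Lemma pder_sum (I : Type) (s : seq I) (P : pred I) (F : I -> X -> k) :
  (forall i, P i -> regular (F i) x) ->
  v (fun y => \sum_(i <- s | P i) F i y) = \sum_(i <- s | P i) v (F i).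
Proof.
move=> rF; elim: s => [|i s IHs].
  by rewrite big_nil; apply: etrans (pder_cst 0); congr v; apply: funext => y; rewrite big_nil.
under [X in v X]funext => y do rewrite big_cons.
rewrite big_cons; case: ifPn => // Pi.
by rewrite pderD ?IHs //; [apply: rF | apply: regular_sum].
Qed.

Lemma pder_prod (I : eqType) (s : seq I) (F : I -> X -> k) : uniq s ->
  (forall i, regular (F i) x) ->
  v (fun y => \prod_(i <- s) F i y) =
  \sum_(i <- s) v (F i) * \prod_(j <- s | j != i) F j x.
Proof.
move=> us rF; elim: s us => [_|i s IHs /= /andP[si us]].
  by rewrite big_nil; apply: etrans (pder_cst 1); congr v; apply: funext => y; rewrite big_nil.
under [X in v X]funext => y do rewrite big_cons.
rewrite big_cons pderM ?IHs //; last by apply: regular_prod.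
rewrite addrC big_cons eqxx mulrC; congr (_ * _ + _).
  rewrite big_seq_cond [RHS]big_seq_cond; apply: eq_bigl => j.
  by case: eqVneq => [->|]; rewrite ?andbT ?andbF // (negPf si).
rewrite big_distrr /= big_seq [RHS]big_seq; apply: eq_bigr => j js.
rewrite big_cons; case: eqVneq => [ij|_]; last by rewrite mulrCA.
by rewrite ij js in si.
Qed.

Lemma pderX f n : regular f x ->
  v (fun y => f y ^+ n) = n%:R * f x ^+ n.-1 * v f.
Proof.
move=> rf; elim: n => [|n IHn]; first by rewrite (pder_cst 1) !mul0r.
under [X in v X]funext => y do rewrite exprS.
rewrite pderM ?IHn //; last exact: regular_exp.
case: n {IHn} => [|n] /=; first by rewrite expr0; ring.
by rewrite !exprS -!natr1; ring.
Qed.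

End OneDerivation.

(** Stands for [df] being a combination of the [dt_j] with regular coefficients around [x]. Kaehler
    differentials are replaced by their values on the tangent vectors at all nearby points. *)
Definition has_diff x n (t : 'I_n -> X -> k) f : Prop :=
  exists g : 'I_n -> X -> k, (forall j, regular (g j) x) /\
    \forall z \near x, forall v, pder z v -> v f = \sum_j g j z * v (t j).

Section Differentials.
Variables (x : X) (n : nat) (t : 'I_n -> X -> k).

Lemma has_diff_cst a : has_diff x t (fun=> a).
Proof.
exists (fun _ _ => 0); split=> [j|]; first exact: regular_cst.
near=> z => v pv; rewrite (pder_cst pv) big1 // => j _.
by rewrite mul0r.
Unshelve. all: by end_near. Qed.

Lemma has_diff_add f g : regular f x -> regular g x ->
  has_diff x t f -> has_diff x t g -> has_diff x t (fun y => f y + g y).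
Proof.
move=> rf rg [f' [rf' Ef]] [g' [rg' Eg]].
exists (fun j y => f' j y + g' j y); split=> [j|]; first exact: regular_add.
have Rf := near_regular X_charts rf; have Rg := near_regular X_charts rg.
near=> z => v pv; rewrite (pderD pv); [|by near: z..].
rewrite (near Ef z) // (near Eg z) // -big_split /=.
by apply: eq_bigr => j _; rewrite mulrDl.
Unshelve. all: by end_near. Qed.

Lemma has_diff_mul f g : regular f x -> regular g x ->
  has_diff x t f -> has_diff x t g -> has_diff x t (fun y => f y * g y).
Proof.
move=> rf rg [f' [rf' Ef]] [g' [rg' Eg]].
exists (fun j y => f y * g' j y + g y * f' j y); split=> [j|].
  by apply: regular_add => //; apply: regular_mul.
have Rf := near_regular X_charts rf; have Rg := near_regular X_charts rg.
near=> z => v pv; rewrite (pderM pv); [|by near: z..].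
rewrite (near Ef z) // (near Eg z) // !big_distrr -big_split /=.
by apply: eq_bigr => j _; rewrite mulrDl !mulrA.
Unshelve. all: by end_near. Qed.

Lemma has_diff_local f g : regular f x ->
  (\forall y \near x, f y = g y) -> has_diff x t f -> has_diff x t g.
Proof.
move=> rf fg [f' [rf' Ef]]; exists f'; split => //.
have fg' : \forall z \near x, \forall y \near z, f y = g y by apply: nbhs_interior.
have Rf := near_regular X_charts rf.
near=> z => v pv; rewrite -(near Ef z) //; symmetry.
by apply: (pder_local pv); near: z.
Unshelve. all: by end_near. Qed.

Lemma has_diff_inv f : regular f x -> f x != 0 -> has_diff x t f ->
  has_diff x t (fun y => (f y)^-1).
Proof.
move=> rf fx [f' [rf' Ef]].
have ri := regular_inv X_charts fx rf.
exists (fun j y => - (f y)^-1 ^+ 2 * f' j y); split=> [j|].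
  apply: (regular_mul X_charts) => //; apply: (regular_opp X_charts).
  exact: (regular_exp X_charts).
have N := near_neq0 X_charts rf fx; have N' := nbhs_interior N.
have Rf := near_regular X_charts rf; have Ri := near_regular X_charts ri.
near=> z => v pv.
have fz : f z != 0 by near: z.
have rfz : regular f z by near: z.
have riz : regular (fun y => (f y)^-1) z by near: z.
have := pderM pv rfz riz.
rewrite -(@pder_local _ _ pv (fun=> 1)); first last.
- have : \forall y \near z, f y != 0 by near: z.
  by apply: filterS => y fy; rewrite mulfV.
- exact: regular_cst.
rewrite (pder_cst pv) (near Ef z) // => E.
have -> : v (fun y => (f y)^-1) =
    - (f z)^-1 ^+ 2 * \sum_j f' j z * v (t j).
  have {}E : f z * v (fun y => (f y)^-1) =
    - (f z)^-1 * (\sum_j f' j z * v (t j)).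
    by rewrite mulNr; apply/eqP; rewrite -addr_eq0 -E.
  by rewrite -[LHS](mulKf fz) E expr2; ring.
by rewrite big_distrr /=; apply: eq_bigr => j _; rewrite mulrA.
Unshelve. all: by end_near. Qed.

End Differentials.

Lemma has_diff_gen x n (t : 'I_n -> X -> k) (i : 'I_n) : has_diff x t (t i).
Proof.
exists (fun j _ => (j == i)%:R); split=> [j|]; first exact: regular_cst.
near=> z => v pv; rewrite (bigD1 i) //= eqxx mul1r big1 ?addr0 // => j /negPf ->.
by rewrite mul0r.
Unshelve. all: by end_near. Qed.

Lemma has_diff_trans x n N (t : 'I_n -> X -> k) (c : 'I_N -> X -> k) f :
  (forall j, has_diff x t (c j)) -> has_diff x c f -> has_diff x t f.
Proof.
move=> /choice [B Bt] [g [rg Eg]].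
exists (fun i y => \sum_j g j y * B j i y); split=> [i|].
  apply: (regular_sum X_charts) => j _; apply: (regular_mul X_charts) => //.
  by case: (Bt j).
have Eb : \forall z \near x, forall j v, pder z v ->
    v (c j) = \sum_i B j i z * v (t i).
  by apply: filter_forall => j; case: (Bt j).
near=> z => v pv; rewrite (near Eg z) //.
under eq_bigr => j _ do rewrite (near Eb z) // big_distrr.
rewrite exchange_big /=; apply: eq_bigr => i _.
by rewrite big_distrl /=; apply: eq_bigr => j _; rewrite mulrA.
Unshelve. all: by end_near. Qed.

Lemma chart_regular_coord N (U : set X) (c : 'I_N -> X -> k) Z x i :
  is_chart U c Z -> U x -> regular (c i) x.
Proof.
move=> cU Ux; apply/(chart_regular _ cU Ux); exists 'X_i, 1.
rewrite rmorph1 oner_neq0; split=> //; near=> y.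
by rewrite mevalXU rmorph1 divr1.
Unshelve. all: by end_near. Qed.

Lemma chart_regular_mpoly N (U : set X) (c : 'I_N -> X -> k) Z x
    (q : {mpoly k[N]}) :
  is_chart U c Z -> U x -> regular (fun y => q.@[c^~ y]) x.
Proof.
move=> cU Ux; apply/(chart_regular _ cU Ux); exists q, 1.
rewrite rmorph1 oner_neq0; split=> //; near=> y.
by rewrite rmorph1 divr1.
Unshelve. all: by end_near. Qed.

(** A regular function is a fraction of polynomials in the chart coordinates, and the functions with
    a differential contain constants and coordinates and are closed under sums, products and
    inverses. *)
Lemma chart_has_diff N (U : set X) (c : 'I_N -> X -> k) Z x f :
  is_chart U c Z -> U x -> regular f x -> has_diff x c f.
Proof.
move=> cU Ux.
have rm q := chart_regular_mpoly q cU Ux.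
have rc i := chart_regular_coord i cU Ux.
have dm (q : {mpoly k[N]}) : has_diff x c (fun y => q.@[c^~ y]).
  elim/mpolyind: q => [|a mm q _ _ IH].
    by under [X in has_diff _ _ X]funext => y do rewrite meval0; apply: has_diff_cst.
  under [X in has_diff _ _ X]funext => y do rewrite mevalD mevalZ.
  apply: has_diff_add => //.
    apply: (regular_mul X_charts); first exact: regular_cst.
    exact: rm.
  apply: has_diff_mul; [exact: regular_cst|exact: rm|exact: has_diff_cst|].
  under [X in has_diff _ _ X]funext => y do rewrite mevalX.
  suff H (s : seq 'I_N) : regular (fun y => \prod_(i <- s) c i y ^+ mm i) x /\
      has_diff x c (fun y => \prod_(i <- s) c i y ^+ mm i).
    by case: (H (index_enum 'I_N)).
  elim: s => [|i s [IHr IHd]].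
    under [X in regular X]funext => y do rewrite big_nil.
    under [X in has_diff _ _ X]funext => y do rewrite big_nil.
    by split; [exact: regular_cst|exact: has_diff_cst].
  under [X in regular X]funext => y do rewrite big_cons.
  under [X in has_diff _ _ X]funext => y do rewrite big_cons.
  have re e : regular (fun y => c i y ^+ e) x by apply: regular_exp.
  split; first exact: regular_mul.
  apply: has_diff_mul => //.
  elim: (mm i) => [|e IHe].
    under [X in has_diff _ _ X]funext => y do rewrite expr0.
    exact: has_diff_cst.
  under [X in has_diff _ _ X]funext => y do rewrite exprS.
  by apply: has_diff_mul => //; apply: has_diff_gen.
move/(chart_regular _ cU Ux) => [q [r [rx E]]].
apply: (@has_diff_local _ _ _ (fun y => q.@[c^~ y] * (r.@[c^~ y])^-1)).
- by apply: (regular_mul X_charts) => //; apply: (regular_inv X_charts).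
- by apply: filterS E => y ->.
apply: has_diff_mul => //; first exact: (regular_inv X_charts).
exact: has_diff_inv.
Qed.

(* Nakayama's lemma: if [dc = A dt + M dc] with [M x = 0], then [1 - M] is
   invertible near [x]. *)
Lemma nakayama_diff x n N (t : 'I_n -> X -> k) (c : 'I_N -> X -> k)
    (A : 'I_N -> 'I_n -> k) (M : 'I_N -> 'I_N -> X -> k) :
  (forall i j, in_max x (M i j)) ->
  (\forall z \near x, forall v, pder z v -> forall i,
     v (c i) = \sum_j A i j * v (t j) + \sum_j M i j z * v (c j)) ->
  forall i, has_diff x t (c i).
Proof.
move=> Mx E.
pose L y : 'M[k]_N := 1%:M - \matrix_(i, j) M i j y.
have rL i j : regular (fun y => L y i j) x.
  under [X in regular X]funext => y do rewrite !mxE.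
  apply: (regular_sub X_charts); first exact: regular_cst.
  by case: (Mx i j).
have rd := regular_det X_charts rL.
have dx : \det (L x) != 0.
  suff -> : L x = 1%:M by rewrite det1 oner_neq0.
  apply/matrixP => i j; rewrite !mxE; case: (Mx i j) => _ ->.
  by rewrite subr0.
have N0 := near_neq0 X_charts rd dx.
move=> i; exists (fun j y => (\det (L y))^-1 * \sum_l (\adj (L y)) i l * A l j).
split=> [j|].
  apply: (regular_mul X_charts); first exact: regular_inv.
  apply: (regular_sum X_charts) => l _; apply: (regular_mul X_charts).
    exact: regular_adj.
  exact: regular_cst.
near=> z => v pv.
have dz : \det (L z) != 0 by near: z.
have Ez := near E z _ v pv.
have LE : L z *m (\col_i v (c i)) = \col_i \sum_j A i j * v (t j).
  apply/matrixP => a b; rewrite mulmxBl mul1mx !mxE {1}Ez //.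
  by under [X in _ + _ - X]eq_bigr => j _ do rewrite !mxE; rewrite addrK.
have := mul_adj_mx (L z); move: (\adj (L z)) => B BL.
have := congr1 (mulmx B) LE.
rewrite mulmxA BL mul_scalar_mx => /matrixP /(_ i ord0).
rewrite !mxE => Ei; rewrite -[LHS](mulKf dz) Ei.
under eq_bigr => l _ do rewrite mxE big_distrr.
rewrite exchange_big big_distrr; apply: eq_bigr => j _ /=.
rewrite -mulrA; congr (_ * _); rewrite big_distrl.
by apply: eq_bigr => l _; rewrite /= mulrA.
Unshelve. all: by end_near. Qed.

(** Generation of [m / m^2] is known at [x] only, yet the result holds around [x]. Each chart
    coordinate is, up to a constant, a linear combination of the [t_j] plus a sum of products [u w]
    of functions vanishing at [x]; differentiating gives a relation [dc = A dt + M dc] with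
    [M x = 0], to which [nakayama_diff] applies. *)
Lemma cotangent_has_diff x n (t : 'I_n -> X -> k) :
  (forall i, in_max x (t i)) ->
  (forall f, in_max x f -> exists c : 'rV[k]_n,
     in_max2 x (fun y => f y - \sum_(i < n) c 0 i * t i y)) ->
  \forall z \near x, forall f, regular f z -> has_diff z t f.
Proof.
move=> tx tgen; have [N [U [c [Z [cU Ux]]]]] := X_charts x.
have rt i : regular (t i) x by case: (tx i).
have rc i := chart_regular_coord i cU Ux.
pose c0 i y := c i y - c i x.
have rc0 i : regular (c0 i) x.
  by apply: (regular_sub X_charts) => //; apply: regular_cst.
have c0x i : in_max x (c0 i) by split; [exact: rc0|rewrite /c0 subrr].
have [A c0A] := choice (fun i => tgen _ (c0x i)).
have row i : exists M : 'I_N -> X -> k, (forall j, in_max x (M j)) /\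
    \forall z \near x, forall v, pder z v ->
      v (c i) = \sum_j A i ord0 j * v (t j) + \sum_j M j z * v (c j).
  have [m [u [w [uw E]]]] := c0A i.
  have du a : has_diff x c (u a).
    by apply: chart_has_diff cU Ux _; case: (uw a) => -[].
  have dw a : has_diff x c (w a).
    by apply: chart_has_diff cU Ux _; case: (uw a) => _ [].
  have [u' u'E] := choice du; have [w' w'E] := choice dw.
  (* By [d (u w) = u dw + w du]; these coefficients vanish at [x] along with [u] and [w]. *)
  exists (fun j y => \sum_a (u a y * w' a j y + w a y * u' a j y)).
  have ru a : regular (u a) x by case: (uw a) => -[].
  have rw a : regular (w a) x by case: (uw a) => _ [].
  have ru' a j : regular (u' a j) x by case: (u'E a).
  have rw' a j : regular (w' a j) x by case: (w'E a).
  split=> [j|].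
    split.
      by apply: (regular_sum X_charts) => a _; apply: (regular_add X_charts);
         apply: (regular_mul X_charts).
    rewrite big1 // => a _; case: (uw a) => -[_ ->] [_ ->].
    by rewrite !mul0r addr0.
  have E' := nbhs_interior E.
  have Ru : \forall z \near x, forall a, regular (u a) z.
    by apply: filter_forall => a; apply: (near_regular X_charts).
  have Rw : \forall z \near x, forall a, regular (w a) z.
    by apply: filter_forall => a; apply: (near_regular X_charts).
  have Rt : \forall z \near x, forall a, regular (t a) z.
    by apply: filter_forall => a; apply: (near_regular X_charts).
  have Eu : \forall z \near x, forall a v, pder z v ->
      v (u a) = \sum_j u' a j z * v (c j).
    by apply: filter_forall => a; case: (u'E a).
  have Ew : \forall z \near x, forall a v, pder z v ->
      v (w a) = \sum_j w' a j z * v (c j).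
    by apply: filter_forall => a; case: (w'E a).
  have Rc := near_regular X_charts (rc i).
  near=> z => v pv.
  have Rtz : forall a, regular (t a) z by near: z.
  have Ruz : forall a, regular (u a) z by near: z.
  have Rwz : forall a, regular (w a) z by near: z.
  have rs : regular (fun y => \sum_(j < n) A i ord0 j * t j y) z.
    by apply: (regular_sum X_charts) => j _; apply: (regular_mul X_charts) => //;
       apply: regular_cst.
  have rcz : regular (c i) z by near: z.
  have rc0z : regular (c0 i) z.
    by apply: (regular_sub X_charts) => //; apply: regular_cst.
  have E'z : \forall y \near z, c0 i y - \sum_(j < n) A i ord0 j * t j y =
      \sum_(a < m) u a y * w a y by near: z.
  have := pder_local pv (regular_sub X_charts rc0z rs) E'z.
  rewrite (pderB pv) // (pderB pv) //; last exact: regular_cst.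
  rewrite (pder_cst pv) subr0 (pder_sum pv); last first.
    by move=> j _; apply: (regular_mul X_charts) => //; apply: regular_cst.
  rewrite (pder_sum pv); last by move=> j _; apply: (regular_mul X_charts).
  move=> /eqP; rewrite subr_eq => /eqP ->.
  rewrite addrC; congr (_ + _).
    by apply: eq_bigr => j _; rewrite (pderZ pv).
  under [RHS]eq_bigr => j _ do rewrite big_distrl.
  rewrite exchange_big /=; apply: eq_bigr => a _.
  rewrite (pderM pv) // (near Eu z) // (near Ew z) // !big_distrr -big_split /=.
  by apply: eq_bigr => j _; rewrite mulrDl !mulrA.
have [M ME] := choice row.
have Mmax i j : in_max x (M i j) by case: (ME i) => H _; apply: H.
have dc i : has_diff x t (c i).
  apply: (nakayama_diff (A := fun i j => A i ord0 j) Mmax) i.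
  have : \forall z \near x, forall i v, pder z v ->
      v (c i) = \sum_j A i ord0 j * v (t j) + \sum_j M i j z * v (c j).
    by apply: filter_forall => i; case: (ME i).
  by apply: filterS => z H v pv i; apply: H.
have [B BE] := choice dc.
have RB : \forall z \near x, forall i j, regular (B i j) z.
  apply: filter_forall => i; apply: filter_forall => j.
  by apply: (near_regular X_charts); case: (BE i).
have EB : \forall z \near x, \forall z' \near z, forall i v, pder z' v ->
    v (c i) = \sum_j B i j z' * v (t j).
  by apply: nbhs_interior; apply: filter_forall => i; case: (BE i).
have NU : \forall z \near x, U z.
  by case: cU => oU _ _ _ _; apply: open_nbhs_nbhs.
near=> z => f rf.
apply: (@has_diff_trans _ _ _ _ c); last first.
  by apply: chart_has_diff cU _ rf; near: z.
move=> i; exists (B i); split=> [j|]; first by move: i j; near: z.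
have : \forall z' \near z, forall i v, pder z' v ->
    v (c i) = \sum_j B i j z' * v (t j) by near: z.
by apply: filterS => z' H v; apply: H.
Unshelve. all: by end_near. Qed.

End PointDerivations.

(** * Determinants as alternating forms *)

Section AlternatingForms.
Variables (R : comNzRingType) (n : nat).

Definition set_row (i : 'I_n) (u : 'rV[R]_n) (M : 'M[R]_n) : 'M[R]_n :=
  \matrix_(a, b) if a == i then u 0 b else M a b.

Lemma row_set_row i u M : row i (set_row i u M) = u.
Proof. by apply/rowP => j; rewrite !mxE eqxx. Qed.

Lemma row_set_row_neq i j u M : j != i -> row j (set_row i u M) = row j M.
Proof. by move=> ji; apply/rowP => b; rewrite !mxE (negPf ji). Qed.

Lemma set_row_row i (M : 'M[R]_n) : set_row i (row i M) M = M.
Proof. by apply/matrixP => a b; rewrite !mxE; case: eqVneq => // ->. Qed.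

Definition multilinear (F : 'M[R]_n -> R) := forall M i c u w,
  F (set_row i (c *: u + w) M) = c * F (set_row i u M) + F (set_row i w M).

Definition alternate (F : 'M[R]_n -> R) := forall (M : 'M[R]_n) i j,
  i != j -> row i M = row j M -> F M = 0.

Lemma det_multilinear : multilinear (fun M => \det M).
Proof.
move=> M i c u w; rewrite -[\det (set_row i w M)]mul1r.
apply: (@determinant_multilinear _ _ _ _ _ i).
- by rewrite !row_set_row scale1r.
- by apply/matrixP => a b; rewrite !mxE eq_sym (negPf (neq_lift _ _)).
- by apply/matrixP => a b; rewrite !mxE eq_sym (negPf (neq_lift _ _)).
Qed.

Lemma det_alternate : alternate (fun M => \det M).
Proof.
move=> M i j ij E; apply: (determinant_alternate ij) => b.
by have /rowP/(_ b) := E; rewrite !mxE.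
Qed.

Lemma multilinear0 F (M : 'M[R]_n) i : multilinear F -> F (set_row i 0 M) = 0.
Proof.
move=> Flin; have := Flin M i 1 0 0.
rewrite scaler0 addr0 mul1r => /eqP.
by rewrite -subr_eq0 opprD addNKr oppr_eq0 => /eqP.
Qed.

Lemma multilinearZ F (M : 'M[R]_n) i c u :
  multilinear F -> F (set_row i (c *: u) M) = c * F (set_row i u M).
Proof. by move=> Flin; rewrite -[c *: u]addr0 Flin multilinear0 ?addr0. Qed.

Lemma multilinear_sum F (M : 'M[R]_n) i (I : Type) (s : seq I)
    (u : I -> 'rV[R]_n) (c : I -> R) : multilinear F ->
  F (set_row i (\sum_(l <- s) c l *: u l) M) =
  \sum_(l <- s) c l * F (set_row i (u l) M).
Proof.
move=> Flin; elim: s => [|l s IHs]; last by rewrite !big_cons Flin IHs.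
by rewrite !big_nil multilinear0.
Qed.

(** Polarization: expand the value on the matrix whose rows [i] and [j] both equal the sum of the
    two rows. *)
Lemma alternate_xrow F (M : 'M[R]_n) i j :
  multilinear F -> alternate F -> i != j -> F (xrow i j M) = - F M.
Proof.
move=> Flin Falt ij; have ji : j != i by rewrite eq_sym.
pose H v w := F (set_row i v (set_row j w M)).
have HE v : H v v = 0.
  by apply: (Falt _ i j) => //; rewrite row_set_row row_set_row_neq // row_set_row.
have HDl u v w : H (u + v) w = H u w + H v w.
  by rewrite /H -[u]scale1r Flin mul1r scale1r.
have HDr u v w : H w (u + v) = H w u + H w v.
  have C a b : set_row i a (set_row j b M) = set_row j b (set_row i a M).
    apply/matrixP => l m; rewrite !mxE.
    by case: (eqVneq l i) => [->|//]; rewrite (negPf ij).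
  by rewrite /H !C -[u]scale1r Flin mul1r scale1r.
have -> : xrow i j M = set_row i (row j M) (set_row j (row i M) M).
  apply/matrixP => a b; rewrite !mxE.
  case: (eqVneq a i) => [->|ai]; first by rewrite tpermL.
  case: (eqVneq a j) => [->|aj]; first by rewrite tpermR.
  by rewrite tpermD // eq_sym.
have <- : H (row i M) (row j M) = F M by rewrite /H !set_row_row.
have := HE (row i M + row j M); rewrite HDl !HDr !HE addr0 add0r => /eqP.
by rewrite addrC addr_eq0 => /eqP.
Qed.

(** Expanding the rows in the standard basis reduces to matrices whose rows are basis vectors. Such
    a matrix has two equal rows or is a permutation matrix, which transpositions bring back to the
    identity. *)
Lemma alternate_eq0 F (M : 'M[R]_n) :
  multilinear F -> alternate F -> F 1%:M = 0 -> F M = 0.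
Proof.
move=> Flin Falt F1.
have Fperm (s : 'S_n) : F (perm_mx s) = 0.
  case: (prod_tpermP s) => ts -> /=; elim: ts => [_|[i j] ts IHts /=].
    by rewrite big_nil perm_mx1.
  case/andP=> ij dts; rewrite big_cons perm_mxM -/(tperm_mx i j) -xrowE.
  by rewrite alternate_xrow // IHts ?oppr0.
have delta A : (forall i, exists j, row i A = delta_mx 0 j) -> F A = 0.
  move=> /choice [f fE].
  have [injf|/injectivePn [i [j ij fij]]] := altP (injectiveP f).
    have -> : A = perm_mx (perm injf); last exact: Fperm.
    apply/row_matrixP => i; rewrite fE; apply/rowP => j.
    by rewrite !mxE permE eq_sym.
  by apply: (Falt _ i j) => //; rewrite !fE fij.
(* Induction on the number [m] of initial rows that may fail to be basis vectors. *)
suff H m A : (forall i : 'I_n, (m <= i)%N -> exists j, row i A = delta_mx 0 j) ->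
    F A = 0.
  by apply: (H n) => i; rewrite leqNgt ltn_ord.
elim: m A => [|m IHm] A HA; first by apply: delta => i; apply: HA.
have [nm|mn] := leqP n m.
  by apply: IHm => i /(leq_trans nm); rewrite leqNgt ltn_ord.
pose i := Ordinal mn.
have rA : row i A = \sum_j A i j *: delta_mx 0 j.
  by rewrite {1}(row_sum_delta (row i A)); apply: eq_bigr => j _; rewrite mxE.
rewrite -(set_row_row i A) rA multilinear_sum // big1 // => j _.
rewrite IHm ?mulr0 // => a; rewrite leq_eqVlt => /orP[/eqP ma|ma].
  have -> : a = i by apply: val_inj.
  by exists j; rewrite row_set_row.
rewrite row_set_row_neq; first exact: HA.
by rewrite -val_eqE /= gtn_eqF.
Qed.

Lemma alternate_det F (M : 'M[R]_n) :
  multilinear F -> alternate F -> F M = \det M * F 1%:M.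
Proof.
move=> Flin Falt; apply/eqP; rewrite -subr_eq0; apply/eqP.
apply: (@alternate_eq0 (fun A => F A - \det A * F 1%:M)).
- by move=> A i c u w; rewrite Flin det_multilinear; ring.
- move=> A i j ij E; rewrite (Falt _ _ _ ij E) (det_alternate ij E).
  by rewrite mul0r subrr.
- by rewrite det1 mul1r subrr.
Qed.

End AlternatingForms.

(** * Local coordinates *)

Section Coordinates.
Variables (k : closedFieldType) (X : kspace k).
Hypothesis X_charts : has_charts X.
Implicit Types (x y : X) (f g : X -> k).

Lemma regular_upd m (a : 'I_m -> X -> k) i f x :
  (forall j, regular (a j) x) -> regular f x ->
  forall j, regular ([eta a with i |-> f] j) x.
Proof. by move=> ra rf j /=; case: eqP. Qed.

Lemma upd_id m (a : 'I_m -> X -> k) i : [eta a with i |-> a i] = a :> (_ -> _).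
Proof. by apply: funext => j /=; case: eqP => // ->. Qed.

Lemma polyvector_pder (U : set X) m (P : op X m) x a i :
  polyvector U P -> U x -> (forall j, regular (a j) x) ->
  pder x (fun f => P [eta a with i |-> f] x).
Proof.
move=> PU Ux ra; split=> [f g rf fg|c f g rf rg|f g rf rg].
- have [_ H _ _ _] := PU x Ux _ (regular_upd i ra rf); apply: H => j /=.
  by case: eqP => // _; near=> y.
- by have [_ _ _ H _] := PU x Ux a ra; apply: H.
- by have [_ _ _ _ H] := PU x Ux a ra; apply: H.
Unshelve. all: by end_near. Qed.

Lemma polyvector_regular (U : set X) m (P : op X m) x a :
  polyvector U P -> U x -> (forall j, regular (a j) x) -> regular (P a) x.
Proof. by move=> PU Ux ra; case: (PU x Ux a ra). Qed.

Lemma polyvector_alt (U : set X) m (P : op X m) x a i j :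
  polyvector U P -> U x -> (forall j, regular (a j) x) ->
  i != j -> a i = a j -> P a x = 0.
Proof. by move=> PU Ux ra; case: (PU x Ux a ra) => _ _ H _ _; apply: H. Qed.

Lemma polyvector_sub (U V : set X) m (P : op X m) :
  V `<=` U -> polyvector U P -> polyvector V P.
Proof. by move=> VU PU x /VU; apply: PU. Qed.

(** The last hypothesis says only that the [dt_i] span; their independence follows by comparison
    with a basis [u] of the cotangent space at [y]. The coordinates of [f - f y] in that basis are
    derivations [w_i] dual to [u], which a change of basis makes dual to [t]. *)
Lemma dual_pder y n (t : 'I_n -> X -> k) :
  cotangent_dim y n -> (forall i, regular (t i) y) ->
  (forall f, regular f y -> has_diff y t f) ->
  exists v : 'I_n -> (X -> k) -> k,
    forall i, pder y (v i) /\ forall j, v i (t j) = (i == j)%:R.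
Proof.
move=> [u [um ub]] rt dt.
have ru i : regular (u i) y by case: (um i).
have rl (c : 'rV[k]_n) : regular (fun z => \sum_(i < n) c 0 i * u i z) y.
  by apply: (regular_sum X_charts) => i _; apply: (regular_mul X_charts) => //;
     apply: regular_cst.
pose f0 f z := f z - f y.
have f0m f : regular f y -> in_max y (f0 f).
  move=> rf; split; last by rewrite /f0 subrr.
  by apply: (regular_sub X_charts) => //; apply: regular_cst.
pose S f (c : 'rV[k]_n) := in_max2 y (fun z => f0 f z - \sum_(i < n) c 0 i * u i z).
pose co f : 'rV[k]_n := xget 0 [set c | S f c].
have coP f : regular f y -> S f (co f).
  move=> rf; rewrite /co; case: xgetP => // H.
  by have [c [Sc _]] := ub _ (f0m f rf); have := H c.
have coE f c : regular f y -> S f c -> co f = c.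
  move=> rf Sc; have [c' [_ H]] := ub _ (f0m f rf).
  by rewrite -(H _ Sc) -(H _ (coP f rf)).
have m2local f g : (\forall z \near y, f z = g z) -> in_max2 y f -> in_max2 y g.
  move=> fg [M [a [b [ab E]]]]; exists M, a, b; split => //.
  by near=> z; rewrite -(near fg z) //; near: z.
have m2add f g : in_max2 y f -> in_max2 y g -> in_max2 y (fun z => f z + g z).
  move=> [M [a [b [ab E]]]] [M' [a' [b' [ab' E']]]].
  exists (M + M')%N, (fun i => match fintype.split i with inl j => a j | inr j => a' j end).
  exists (fun i => match fintype.split i with inl j => b j | inr j => b' j end).
  split=> [i|]; first by case: fintype.split.
  near=> z; rewrite (near E z) // (near E' z) // big_split_ord /=.
  congr (_ + _); apply: eq_bigr => i _.
    by rewrite -[lshift _ _]/(unsplit (inl i)) unsplitK.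
  by rewrite -[rshift _ _]/(unsplit (inr i)) unsplitK.
have m2scale (h : X -> k) f : regular h y -> in_max2 y f -> in_max2 y (fun z => h z * f z).
  move=> rh [M [a [b [ab E]]]].
  exists M, (fun i z => h z * a i z), b; split=> [i|].
    have [[r1 v1] b1] := ab i; split=> //; split; last by rewrite v1 mulr0.
    exact: regular_mul.
  near=> z; rewrite (near E z) // big_distrr /=.
  by apply: eq_bigr => i _; rewrite mulrA.
pose w i f := co f 0 i.
have pw i : pder y (w i).
  split=> [f g rf fg|c f g rf rg|f g rf rg]; rewrite /w.
  - have rg : regular g y by apply: regular_local fg rf.
    have fgy := nbhs_singleton fg.
    rewrite (coE g (co f)) //; have := coP f rf; apply: m2local.
    by near=> z; rewrite /f0 (near fg z) // fgy.
  - have rfg : regular (fun z => c * f z + g z) y.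
      apply: (regular_add X_charts) => //; apply: (regular_mul X_charts) => //.
      exact: regular_cst.
    rewrite (coE _ (c *: co f + co g)) ?mxE //.
    have := m2add _ _ (m2scale _ _ (regular_cst X_charts y c) (coP f rf)) (coP g rg).
    apply: m2local; near=> z; rewrite /f0.
    under [in RHS]eq_bigr => j _ do rewrite !mxE mulrDl -mulrA.
    by rewrite big_split -big_distrr /=; ring.
  - have rfg : regular (fun z => f z * g z) y by apply: regular_mul.
    rewrite (coE _ (f y *: co g + g y *: co f)) ?mxE //.
    (* The difference of [f g] and its value at [y] is [f y] times [f0 g], plus [g y] times [f0 f],
       plus this product, which lies in [m^2]. *)
    have fg : in_max2 y (fun z => f0 f z * f0 g z).
      exists 1%N, (fun=> f0 f), (fun=> f0 g); split=> [_|].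
        by split; apply: f0m.
      by near=> z; rewrite big_ord1.
    have := m2add _ _ (m2add _ _ (m2scale _ _ (regular_cst X_charts y (f y)) (coP g rg))
      (m2scale _ _ (regular_cst X_charts y (g y)) (coP f rf))) fg.
    apply: m2local; near=> z; rewrite /f0.
    under [in RHS]eq_bigr => j _ do rewrite !mxE mulrDl -!mulrA.
    by rewrite big_split -!big_distrr /=; ring.
have wu i j : w i (u j) = (i == j)%:R.
  rewrite /w (coE _ (delta_mx 0 j)) ?mxE //.
  exists 0%N, (fun _ _ => 0), (fun _ _ => 0); split=> [[]//|]; near=> z.
  rewrite big_ord0 (bigD1 j) //= mxE !eqxx mul1r big1 ?addr0.
    by rewrite /f0; have [_ ->] := um j; rewrite subr0 subrr.
  by move=> l lj; rewrite mxE (negPf lj) mul0r.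
have [g gE] := choice (fun j => dt _ (ru j)).
pose W : 'M[k]_n := \matrix_(i, l) w i (t l).
pose G : 'M[k]_n := \matrix_(l, j) g j l y.
have WG : W *m G = 1%:M.
  apply/matrixP => i j; rewrite !mxE -wu.
  have [_ /nbhs_singleton/(_ _ (pw i)) ->] := gE j.
  by apply: eq_bigr => l _; rewrite !mxE mulrC.
(* Both families have [n] members, so the one-sided inverse is two-sided: spanning implies
   independence. *)
have GW := mulmx1C WG.
exists (fun i f => \sum_l G i l * w l f) => i; split=> [|j].
  split=> [f h rf fh|c f h rf rh|f h rf rh].
  - by apply: eq_bigr => l _; congr (_ * _); apply: (pder_local (pw l)).
  - rewrite big_distrr -big_split /=; apply: eq_bigr => l _.
    by case: (pw l) => _ -> // _; rewrite mulrDr mulrCA.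
  - rewrite !big_distrr -big_split /=; apply: eq_bigr => l _.
    by rewrite (pderM (pw l)) // mulrDr; congr (_ + _); rewrite mulrCA.
have /matrixP/(_ i j) := GW; rewrite !mxE => <-.
by apply: eq_bigr => l _; rewrite !mxE.
Unshelve. all: by end_near. Qed.

Definition vfield (U : set X) (D : (X -> k) -> X -> k) : Prop :=
  forall x, U x -> (forall f, regular f x -> regular (D f) x) /\
    pder x (fun f => D f x).

(** Etale coordinates, with the frame [d] of partial derivatives as part of the data. Together, the
    last two clauses make the [d_j] a basis of the tangent space at every point of [V]. *)
Definition coords (V : set X) n (t : 'I_n -> X -> k)
    (d : 'I_n -> (X -> k) -> X -> k) : Prop :=
  [/\ open V, (forall i, regular_on V (t i)),
      (forall i, vfield V (d i)),
      (forall i j y, V y -> d i (t j) y = (i == j)%:R) &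
      (forall y v f, V y -> pder y v -> regular f y ->
         v f = \sum_j d j f y * v (t j))].

(** The dual basis is chosen at each point on its own. It still varies regularly: in a relation
    [df = \sum_j g_j dt_j] valid around [y], duality forces [d_j f = g_j]. *)
Lemma exists_coords n x : is_nonsingular X n ->
  exists V t d, @coords V n t d /\ V x.
Proof.
move=> X_ns; have [_ [t [tm tb]]] := X_ns x.
have tb' f : in_max x f -> exists c : 'rV[k]_n,
     in_max2 x (fun y => f y - \sum_(i < n) c 0 i * t i y).
  by move=> /tb [c [Hc _]]; exists c.
have E := cotangent_has_diff X_charts tm tb'.
have R : \forall y \near x, forall i, regular (t i) y.
  by apply: filter_forall => i; apply: (near_regular X_charts); case: (tm i).
have : \forall y \near x, (forall i, regular (t i) y) /\
    forall f, regular f y -> has_diff y t f by apply: filterI.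
rewrite /prop_near1 nbhsE => -[V [oV Vx] VE].
pose Q y (v : 'I_n -> (X -> k) -> k) :=
  forall i, pder y (v i) /\ forall j, v i (t j) = (i == j)%:R.
pose d i f y := xget (fun _ _ => 0) [set v | Q y v] i f.
have dQ y : V y -> Q y (fun i f => d i f y).
  move=> /VE [rt dt]; rewrite /d; case: xgetP => // H.
  have [_ cy] := X_ns y; have [v vQ] := dual_pder cy rt dt.
  by have := H v vQ.
have key y f : V y -> regular f y -> exists g : 'I_n -> X -> k,
    (forall j, regular (g j) y) /\
    \forall z \near y, (forall j, d j f z = g j z) /\
      forall v, pder z v -> v f = \sum_j g j z * v (t j).
  move=> Vy rf; have [_ /(_ _ rf) [g [rg Eg]]] := VE _ Vy.
  exists g; split=> //.
  have NV : \forall z \near y, V z by apply: open_nbhs_nbhs.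
  near=> z; split=> [j|]; last by near: z.
  have Vz : V z by near: z.
  have [pd dt] := dQ z Vz j.
  rewrite (near Eg z _ (fun f => d j f z)) //.
  rewrite (bigD1 j) //= dt eqxx mulr1 big1 ?addr0 // => l lj.
  by rewrite dt eq_sym (negPf lj) mulr0.
exists V, t, d; split=> //; split=> //.
- by move=> i y /VE [].
- move=> i y Vy; split=> [f rf|]; last by case: (dQ y Vy i).
  have [g [rg Eg]] := key y f Vy rf.
  by apply: regular_local (rg i) => //; apply: filterS Eg => z [->].
- by move=> i j y Vy; case: (dQ y Vy i).
- move=> y v f Vy pv rf; have [g [rg Eg]] := key y f Vy rf.
  have [dg vg] := nbhs_singleton Eg; rewrite vg //.
  by apply: eq_bigr => j _; rewrite dg.
Unshelve. all: by end_near. Qed.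

Lemma coords_sub (V W : set X) n (t : 'I_n -> X -> k) d :
  coords V t d -> open W -> W `<=` V -> coords W t d.
Proof.
case=> oV rt dv dt vd oW WV; split=> //.
- by move=> i x /WV; apply: rt.
- by move=> i x /WV; apply: dv.
- by move=> i j x /WV; apply: dt.
- by move=> y v f /WV; apply: vd.
Qed.

Section Generator.
Variables (V : set X) (n : nat) (t : 'I_n -> X -> k).
Variable d : 'I_n -> (X -> k) -> X -> k.
Hypothesis tV : coords V t d.

Lemma coords_open : open V. Proof. by case: tV. Qed.

(** At [y] the value of [P] is an alternating function of the rows of the Jacobian matrix [d_j a_i],
    hence its determinant times the value on the identity matrix, which is the Jacobian matrix of
    [t]. *)
Lemma polyvector_coords (W : set X) (P : op X n) a y :
  polyvector W P -> W y -> V y -> (forall i, regular (a i) y) ->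
  P a y = wedge_fields d a y * P t y.
Proof.
move=> PW Wy Vy ra; have [_ rt dv dt vd] := tV.
have rty i : regular (t i) y by apply: rt.
pose l (u : 'rV[k]_n) z := \sum_j u 0 j * t j z.
have rl u : regular (l u) y.
  by apply: (regular_sum X_charts) => j _; apply: (regular_mul X_charts) => //;
     apply: regular_cst.
have vl v u : pder y v -> v (l u) = \sum_j u 0 j * v (t j).
  move=> pv; rewrite (pder_sum X_charts pv) => [|j _]; last first.
    by apply: (regular_mul X_charts) => //; apply: regular_cst.
  by apply: eq_bigr => j _; rewrite (pderZ X_charts pv).
pose F (M : 'M[k]_n) := P (fun i => l (row i M)) y.
have Fset M i u : F (set_row i u M) =
    P [eta (fun j => l (row j M)) with i |-> l u] y.
  congr (P _ _); apply: funext => j /=.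
  by case: eqVneq => [->|ji]; rewrite ?row_set_row ?row_set_row_neq.
have Flin : multilinear F.
  move=> M i c u w; rewrite !Fset.
  have pv : pder y (fun f => P [eta (fun j => l (row j M)) with i |-> f] y).
    by apply: polyvector_pder PW Wy _.
  rewrite !(vl _ _ pv) big_distrr -big_split /=; apply: eq_bigr => j _.
  by rewrite !mxE; ring.
have Falt : alternate F.
  by move=> M i j ij E; apply: (polyvector_alt PW Wy _ ij); rewrite ?E.
pose G : 'M[k]_n := \matrix_(i, j) d j (a i) y.
have -> : P a y = F G.
  (* The first [m] arguments are replaced by linear functions of [t] with the same differential at
     [y]; one replacement at a time leaves the value unchanged. *)
  pose b m (i : 'I_n) := if (i < m)%N then l (row i G) else a i.
  have rb m i : regular (b m i) y by rewrite /b; case: ifP.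
  have bn : P a y = P (b n) y -> P a y = F G.
    move=> ->; congr (P _ y); apply: funext => i.
    by rewrite /b ltn_ord.
  apply: bn; elim: {-2}n (leqnn n) => [_|m IHm mn].
    by congr (P _ y); apply: funext.
  rewrite (IHm (ltnW mn)); pose i := Ordinal mn.
  have -> : b m = [eta b m with i |-> a i] :> (_ -> _).
    by apply: funext => j /=; case: eqVneq => // ->; rewrite /b /= ltnn.
  have -> : b m.+1 = [eta b m with i |-> l (row i G)] :> (_ -> _).
    apply: funext => j /=; rewrite /b ltnS leq_eqVlt -val_eqE /=.
    by case: eqVneq => // E; congr (l (row _ G)); apply: val_inj.
  have pv := polyvector_pder i PW Wy (rb m).
  rewrite (vd _ _ _ Vy pv (ra i)) (vl _ _ pv).
  by apply: eq_bigr => j _; rewrite !mxE.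
rewrite (alternate_det G Flin Falt); congr (_ * _).
  rewrite /wedge_fields -det_tr; congr (\det _).
  by apply/matrixP => i j; rewrite !mxE.
congr (P _ y); apply: funext => i; apply: funext => z; rewrite /l (bigD1 i) //=.
rewrite !mxE eqxx mul1r big1 ?addr0 // => j ji.
by rewrite !mxE eq_sym (negPf ji) mul0r.
Qed.

Lemma wedge_upd a i f y : wedge_fields d [eta a with i |-> f] y =
  \det (set_row i (\row_j d j f y) (\matrix_(i, j) d j (a i) y)).
Proof.
rewrite /wedge_fields -det_tr; congr (\det _).
by apply/matrixP => b c; rewrite !mxE /=; case: eqP.
Qed.

Lemma wedge_polyvector : polyvector V (wedge_fields d).
Proof.
have [_ rt dv dt vd] := tV.
move=> x Vx a ra; have pd i : pder x (fun f => d i f x) by case: (dv i x Vx).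
split.
- apply: (regular_det X_charts) => i j.
  under [X in regular X]funext => z do rewrite mxE.
  by case: (dv i x Vx) => H _; apply: H.
- move=> b ab; congr (\det _); apply/matrixP => i j; rewrite !mxE.
  exact: (pder_local (pd i)).
- move=> i j ij E; rewrite /wedge_fields -det_tr.
  by apply: (determinant_alternate ij) => c; rewrite !mxE E.
- move=> i f g c rf rg; rewrite !wedge_upd.
  rewrite -det_multilinear; congr (\det (set_row _ _ _)).
  apply/rowP => j; rewrite !mxE.
  by case: (pd j) => _ -> // _.
- move=> i f g rf rg; rewrite !wedge_upd.
  have -> : \row_j d j (fun y => f y * g y) x =
     f x *: (\row_j d j g x) + g x *: \row_j d j f x.
    by apply/rowP => j; rewrite !mxE (pderM (pd j)).
  by rewrite det_multilinear (multilinearZ _ _ _ _ (@det_multilinear _ _)).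
Qed.

End Generator.
End Coordinates.

(** * Exact forms and the Cartier operator *)

Section FrobeniusDerivations.
Variables (k : closedFieldType) (X : kspace k).
Hypothesis X_charts : has_charts X.
Variables (V : set X) (n : nat) (t : 'I_n -> X -> k).
Variable d : 'I_n -> (X -> k) -> X -> k.
Hypothesis tV : coords V t d.

(** Expand [df] in the [dt_j]: for [j != i] the term repeats the argument [t_j]. *)
Lemma polyvector_upd_coord (W : set X) (P : op X n) y i f :
  polyvector W P -> W y -> V y -> regular f y ->
  P [eta t with i |-> f] y = d i f y * P t y.
Proof.
move=> PW Wy Vy rf; have [oV rt dv dt vd] := tV.
have rty j : regular (t j) y by apply: rt.
rewrite (vd _ _ _ Vy (polyvector_pder i PW Wy rty) rf).
rewrite (bigD1 i) //= upd_id big1 ?addr0 // => j ji.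
rewrite (polyvector_alt (i := i) (j := j) PW Wy) ?mulr0 //=.
- exact: regular_upd.
- by rewrite eq_sym.
- by rewrite eqxx (negPf ji).
Qed.

Lemma generates_coords : generates V (dwedge t).
Proof.
have [oV rt dv dt vd] := tV; have PV := wedge_polyvector X_charts tV.
split=> [x Vx|W eta oW WV fW].
  exists V, 1%N, (fun _ _ => 1), (fun=> t); split=> //.
    by move=> _; split=> // y _; apply: regular_cst.
  by move=> y Vy W P oW Wy PW; rewrite big_ord1 /form_scale mul1r.
(* The coefficient of [dt_1 ... dt_n] is the value of the form on the dual frame
   [d_1 ^ ... ^ d_n]. *)
exists (eta (wedge_fields d)).
  move=> x Wx; have [U [M [f [a [oU Ux rfa E]]]]] := fW x Wx.
  have UW : open (U `&` W) by apply: openI.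
  apply: (@regular_local _ _ X_charts _
     (fun y => \sum_(i < M) f i y * wedge_fields d (a i) y)).
    have NU : \forall y \near x, U y /\ W y.
      by apply: (@open_nbhs_nbhs _ _ (U `&` W)); split.
    near=> y; have [Uy Wy] : U y /\ W y by near: y.
    by rewrite (E _ Uy V) //; apply: WV.
  apply: (regular_sum X_charts) => i _; apply: (regular_mul X_charts).
    by case: (rfa i) => H _; apply: H.
  apply: (polyvector_regular PV (WV _ Wx)) => j.
  by case: (rfa i) => _; apply.
move=> x Wx U Q oU Ux QU; have [W' [M [f [a [oW' W'x rfa E]]]]] := fW x Wx.
have Vx := WV _ Wx.
rewrite /form_scale (E _ W'x V _ oV Vx PV) (E _ W'x U _ oU Ux QU) big_distrl /=.
apply: eq_bigr => i _; rewrite /form_scale /dwedge -mulrA; congr (_ * _).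
apply: (polyvector_coords X_charts tV QU Ux Vx) => j.
by case: (rfa i) => _; apply.
Unshelve. all: by end_near. Qed.

Lemma is_form_sum (I : Type) (s : seq I) (a : I -> 'I_n -> X -> k) :
  (forall i j, regular_on V (a i j)) ->
  is_form V (fun P y => \sum_(i <- s) dwedge (a i) P y).
Proof.
move=> ra x Vx; exists V, (size s), (fun _ _ => 1), (fun i => a (tnth (in_tuple s) i)).
split=> //; first by case: tV.
  by move=> i; split=> // y _; apply: regular_cst.
move=> y Vy W P oW Wy PW; rewrite big_tnth; apply: eq_bigr => i _.
by rewrite /form_scale mul1r.
Qed.

Lemma is_form_scale f (a : 'I_n -> X -> k) : regular_on V f ->
  (forall j, regular_on V (a j)) -> is_form V (form_scale f (dwedge a)).
Proof.
move=> rf ra x Vx; exists V, 1%N, (fun=> f), (fun=> a); split=> //.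
  by case: tV.
by move=> y Vy W P oW Wy PW; rewrite big_ord1.
Qed.

Section Cartier.
Variables (p : nat) (C : diff_form X n -> diff_form X n).
Hypothesis C_cartier : is_cartier p C.

Lemma cartier_sum (s : seq 'I_n) (a : 'I_n -> 'I_n -> X -> k) :
  (forall i j, regular_on V (a i j)) ->
  form_eq V (C (fun P y => \sum_(i <- s) dwedge (a i) P y)) (fun _ _ => 0).
Proof.
move=> ra; have [oV _ _ _ _] := tV.
have [C1 C2 C3 C4 _] := C_cartier oV.
have r1 : regular_on V (fun=> 1) by move=> y _; apply: regular_cst.
(* Additivity of [C] is its [p^-1]-linearity with scalar [1 = 1 ^ p], applied up to equality of
   forms on [V]. *)
have step (eta eta1 eta2 : diff_form X n) :
    is_form V eta -> is_form V eta1 -> is_form V eta2 ->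
    form_eq V eta (form_add eta1 eta2) ->
    form_eq V (C eta) (form_add (C eta1) (C eta2)).
  move=> F F1 F2 E x Vx W P oW Wx PW.
  have E' : form_eq V (form_add (form_scale (fun x => 1 ^+ p) eta1) eta2) eta.
    move=> y Vy W' P' oW' Wy PW'.
    by rewrite (E y Vy W') // /form_add /form_scale expr1n mul1r.
  have F' : is_form V (form_add (form_scale (fun x => 1 ^+ p) eta1) eta2).
    move=> y Vy; have [W' [M [f [b [oW' Wy' rfb Eb]]]]] := F y Vy.
    exists (W' `&` V), M, f, b; split=> //; first exact: openI.
      by move=> i; case: (rfb i) => H1 H2; split=> [z [Wz _]|j z [Wz _]];
         [apply: H1|apply: H2].
    move=> z [Wz Vz] U Q oU Uz QU; rewrite (E' _ Vz U) //.
    exact: (Eb _ Wz U).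
  rewrite -(C2 _ _ F' F E' x Vx W) // (C3 (fun=> 1) _ _ r1 F1 F2 x Vx W) //.
  by rewrite /form_add /form_scale mul1r.
(* The empty sum is handled through [C 0 = C 0 + C 0]; a nonempty one provides an index in ['I_n],
   hence the condition [0 < n] under which [C] kills exact forms. *)
elim: s => [|i s IHs] x Vx W P oW Wx PW; last have n0 : (0 < n)%N.
  have Z := @is_form_sum 'I_n [::] a ra.
  have ZZ : form_eq V (fun P y => \sum_(i <- [::]) dwedge (a i) P y)
      (form_add (fun P y => \sum_(i <- [::]) dwedge (a i) P y)
                (fun P y => \sum_(i <- [::]) dwedge (a i) P y)).
    by move=> y _ U Q _ _ _; rewrite /form_add !big_nil addr0.
  have := step _ _ _ Z Z Z ZZ x Vx W P oW Wx PW; rewrite /form_add => /eqP.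
  by rewrite -subr_eq0 opprD addNKr oppr_eq0 => /eqP.
  exact: leq_ltn_trans (leq0n i) (ltn_ord i).
have F1 : is_form V (dwedge (a i)).
  have := @is_form_sum 'I_n [:: i] a ra; congr (is_form V _).
  by apply: funext => Q; apply: funext => y; rewrite big_seq1.
rewrite (step _ (dwedge (a i)) _ _ F1 (is_form_sum s ra) _ x Vx W) //; first last.
- by move=> y _ U Q _ _ _; rewrite /form_add big_cons.
- exact: is_form_sum.
rewrite /form_add (IHs x Vx W) // (C4 (a i) n0 _ x Vx W) ?addr0 //.
Qed.

Hypothesis p_char : p \in [pchar k].
Hypothesis p_gt2 : (2 < p)%N.
Variables (sigma : op X n) (phi : (X -> k) -> X -> k) (D : (X -> k) -> X -> k).
Hypothesis phi_sigma : defined_by p C sigma phi.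
Hypothesis sigma_V : polyvector V sigma.
Hypothesis D_V : vfield V D.
Hypothesis D_sigma : forall y, V y ->
  D (sigma t) y = \sum_i sigma [eta t with i |-> D (t i)] y.

(* With [s = sigma t] one has [L_D (s^(p-1) dt_1 ... dt_n) = 0], so that, by
   Cartan's formula, [D g s^(p-1) dt_1 ... dt_n] is the exact form
   [d (i_D (g s^(p-1) dt_1 ... dt_n))]. *)
Lemma phi_vfield g x : regular_on V g -> V x -> phi (D g) x = 0.
Proof.
move=> rg Vx; have [oV rt dv dt vd] := tV.
have [phi_nsp phiE] := phi_sigma.
pose s := sigma t.
have rs : regular_on V s.
  by move=> y Vy; apply: (polyvector_regular sigma_V Vy) => j; apply: rt.
pose u y := g y * s y ^+ p.-1.
have rse : regular_on V (fun y => s y ^+ p.-1).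
  by move=> y Vy; apply: (regular_exp X_charts); apply: rs.
have ru : regular_on V u.
  by move=> y Vy; apply: (regular_mul X_charts); [apply: rg|apply: rse].
have rD f : regular_on V f -> regular_on V (D f).
  by move=> rf y Vy; case: (D_V Vy) => H _; apply: H; apply: rf.
(* The sum of the [dwedge (b i)] is [d (i_D (u dt_1 ... dt_n))]: the new differential stands in the
   place of [dt_i], which absorbs the sign of the contraction. *)
pose b i : 'I_n -> X -> k := [eta t with i |-> fun z => u z * D (t i) z].
have ruD i : regular_on V (fun z => u z * D (t i) z).
  by move=> y Vy; apply: (regular_mul X_charts); [apply: ru|apply: rD].
have rb i j : regular_on V (b i j).
  by move=> y Vy; apply: regular_upd => [l|]; [apply: rt|apply: ruD].
have rw : regular_on V (fun y => D g y * s y ^+ p.-1).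
  by move=> y Vy; apply: (regular_mul X_charts); [apply: rD|apply: rse].
have F1 := is_form_scale rw rt.
have F2 := is_form_sum (index_enum 'I_n) rb.
have E : form_eq V (form_scale (fun y => D g y * s y ^+ p.-1) (dwedge t))
    (fun P y => \sum_(i < n) dwedge (b i) P y).
  move=> y Vy W P oW Wy PW; rewrite /form_scale /dwedge.
  have pD : pder y (fun f => D f y) by case: (D_V Vy).
  have pd i : pder y (fun f => d i f y) by case: (dv i y Vy).
  (* The divergence of [D] in these coordinates; the invariance of [sigma] says [D s = dvg * s]. *)
  pose dvg := \sum_i d i (D (t i)) y.
  have Ds : D s y = dvg * s y.
    rewrite D_sigma // big_distrl; apply: eq_bigr => i _ /=.
    by apply: (polyvector_upd_coord i sigma_V Vy Vy); apply: rD.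
  under eq_bigr => i _.
    rewrite (polyvector_upd_coord i PW Wy Vy); last exact: ruD.
    rewrite (pderM (pd i)); [|by apply: ru|by apply: rD].
    rewrite mulrDl; over.
  rewrite big_split /= -!big_distrl -!big_distrr /= -/dvg.
  have -> : \sum_i D (t i) y * d i u y = D u y.
    rewrite (vd _ _ _ Vy pD (ru _ Vy)).
    by apply: eq_bigr => i _; rewrite mulrC.
  rewrite -mulrDl; congr (_ * _).
  rewrite (pderM pD); [|by apply: rg|by apply: rse].
  rewrite (pderX X_charts pD); last exact: rs.
  rewrite -/s Ds /u.
  (* So [D (s^(p-1)) = - dvg * s^(p-1)], which cancels the divergence term of the exact form. *)
  have p1 : p.-1%:R = -1 :> k.
    apply/eqP; rewrite -addr_eq0 natr1 prednK ?(ltn_trans _ p_gt2) //.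
    by rewrite (pcharf0 p_char).
  rewrite p1; case: p p_gt2 => [|[|q]] // _ /=.
  by rewrite exprS; ring.
have [_ C2 _ _ _] := C_cartier oV.
have PV := wedge_polyvector X_charts tV.
(* Both sides are evaluated on the frame [d_1 ^ ... ^ d_n], where [dt_1 ... dt_n] takes the value
   1. *)
have G := phiE V (dwedge t) (D g) oV generates_coords (rD _ rg) x Vx V _ oV Vx PV.
move: G; rewrite /form_scale /dwedge /wedge_fields.
have -> : \matrix_(i, j) d i (t j) x = 1%:M.
  by apply/matrixP => i j; rewrite !mxE dt.
rewrite det1 mulr1 => ->.
rewrite (C2 _ _ F1 F2 E x Vx V _ oV Vx PV).
exact: (cartier_sum _ rb Vx oV Vx PV).
Qed.

End Cartier.
End FrobeniusDerivations.

(** * Vector fields generated by the torus *)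

Section TorusDerivations.
Variables (k : closedFieldType) (T : kspace k) (m : nat) (chi : 'I_m -> T -> k).
Hypothesis T_torus : is_torus chi.
Variable X : kspace k.
Hypothesis X_charts : has_charts X.
Variable act : T -> X -> X.
Hypothesis act_T : torus_action chi act.

Lemma torus_point (v : 'I_m -> k) :
  (forall i, v i != 0) -> exists t, forall i, chi i t = v i.
Proof.
move=> v0; have [_ _ H _ _] := T_torus; have [t [[_ E] _]] := H v v0.
by exists t => i; rewrite -E.
Qed.

Lemma torus_neq0 t i : chi i t != 0.
Proof. by have [_ H _ _ _] := T_torus; apply: (H t I). Qed.

Lemma act_comm s t x : act s (act t x) = act t (act s x).
Proof.
have [_ _ H] := act_T.
have [u uE] : exists u, forall i, chi i u = chi i s * chi i t.
  by apply: torus_point => i; rewrite mulf_neq0 ?torus_neq0.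
rewrite -(H s t u) //; apply: H => i.
by rewrite mulrC.
Qed.

(** [T] is commutative, so both sides are chosen from the same set of derivatives. *)
Lemma gen_field_act h t f x :
  gen_field chi act h (fun y => f (act t y)) x = gen_field chi act h f (act t x).
Proof.
rewrite /gen_field; congr (xget _ _); apply/seteqP.
by split=> e /= [q [r [r0 H ->]]]; exists q, r; split=> // s u us rs;
  rewrite -(H s u us rs) act_comm.
Qed.

(** * One-jets along the curve [1 + s h] in the torus *)

Section Curve.
Variable h : 'I_m -> k.

(* [Q s t] holds on the curve [t = 1 + s h] for all but finitely many [s],
   including [s = 0]. *)
Definition near_curve (Q : k -> T -> Prop) : Prop :=
  exists r : {poly k}, r.[0] != 0 /\
    forall s t, (forall i, chi i t = 1 + s * h i) -> r.[s] != 0 -> Q s t.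

(* 1-jet at [s = 0]; [F] depends on [s] as well because for [h = 0] all the
   points of the curve coincide. *)
Definition jet (F : k -> T -> k) (d0 d1 : k) : Prop :=
  exists q r : {poly k}, [/\ r.[0] != 0,
    forall s t, (forall i, chi i t = 1 + s * h i) -> r.[s] != 0 ->
      F s t = q.[s] / r.[s],
    d0 = q.[0] / r.[0] &
    d1 = (q^`() * r - q * r^`()).[0] / r.[0] ^+ 2].

Lemma near_curveI (P Q : k -> T -> Prop) :
  near_curve P -> near_curve Q -> near_curve (fun s t => P s t /\ Q s t).
Proof.
move=> [r [r0 rP]] [r' [r0' rQ]]; exists (r * r'); rewrite hornerM mulf_neq0 //.
split=> // s t st; rewrite hornerM mulf_eq0 negb_or => /andP[rs rs'].
by split; [apply: rP|apply: rQ].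
Qed.

Lemma near_curveS (P Q : k -> T -> Prop) :
  (forall s t, P s t -> Q s t) -> near_curve P -> near_curve Q.
Proof.
by move=> PQ [r [r0 rP]]; exists r; split=> // s t st rs; apply/PQ/rP.
Qed.

Lemma near_curve_poly (r : {poly k}) :
  r.[0] != 0 -> near_curve (fun s _ => r.[s] != 0).
Proof. by exists r. Qed.

Lemma jet_near F G d0 d1 :
  near_curve (fun s t => F s t = G s t) -> jet F d0 d1 -> jet G d0 d1.
Proof.
move=> [r [r0 FG]] [q' [r' [r0' E -> ->]]].
exists (q' * r), (r' * r); split; rewrite ?hornerM ?mulf_neq0 //.
- move=> s t st; rewrite !hornerM mulf_eq0 negb_or => /andP[rs rs'].
  by rewrite -FG // E //; field; rewrite ?rs ?rs'.
- by field; rewrite ?r0 ?r0'.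
- by rewrite !(derivM, hornerM, hornerD, hornerN); field; rewrite ?r0 ?r0'.
Qed.

(** An algebraically closed field is infinite, so two fractions that agree for almost all [s] are
    equal. This makes the choice by [xget] in [gen_field] independent of the fraction. *)
Lemma jet_uniq F d0 d1 e0 e1 : jet F d0 d1 -> jet F e0 e1 -> d0 = e0 /\ d1 = e1.
Proof.
move=> [q1 [r1 [r10 E1 -> ->]]] [q2 [r2 [r20 E2 -> ->]]].
have E : q1 * r2 = q2 * r1.
  (* Its roots are the [s] for which [1 + s h] leaves the torus; elsewhere the curve has a point at
     which the fractions can be compared. *)
  pose z := \prod_i (1 + h i *: 'X).
  have z0 : z.[0] != 0.
    by rewrite horner_prod; apply/prodf_neq0 => i _; rewrite !hornerE ?mulr0 ?addr0 oner_neq0.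
  have nz (r : {poly k}) : r.[0] != 0 -> r != 0.
    by apply: contraNneq => ->; rewrite horner0.
  apply/eqP; rewrite -subr_eq0; apply: contraT => ne.
  have : (q1 * r2 - q2 * r1) * (r1 * r2 * z) != 0.
    by apply: (mulf_neq0 ne); apply: mulf_neq0; rewrite ?mulf_neq0 ?(nz r1) ?(nz r2) ?(nz z).
  move/closed_nonrootP => [s]; rewrite /root !hornerM !mulf_eq0 !negb_or.
  case/andP => H /andP[/andP[s1 s2] sz].
  have [t st] : exists t, forall i, chi i t = 1 + s * h i.
    apply: torus_point => i; apply: contraNneq sz => Hi.
    rewrite horner_prod; apply/prodf_eq0; exists i => //.
    by rewrite !hornerE mulrC Hi.
  move: H; rewrite !hornerE subr_eq0.
  have := E1 s t st s1; rewrite (E2 s t st s2) => /eqP.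
  by rewrite eqr_div // eq_sym => ->.
have E0 : q1.[0] * r2.[0] = q2.[0] * r1.[0] by rewrite -!hornerM E.
have E' : q1^`().[0] * r2.[0] + q1.[0] * r2^`().[0]
        = q2^`().[0] * r1.[0] + q2.[0] * r1^`().[0].
  by rewrite -!hornerM -!hornerD -!derivM E.
split; first by apply/eqP; rewrite eqr_div // E0.
have Q1 : q1.[0] = q2.[0] * r1.[0] / r2.[0] by rewrite -E0 mulfK.
have Q1' : q1^`().[0] = (q2^`().[0] * r1.[0] + q2.[0] * r1^`().[0]
   - q1.[0] * r2^`().[0]) / r2.[0] by rewrite -E' addrK mulfK.
by rewrite !(hornerM, hornerD, hornerN) Q1' Q1; field; rewrite ?r10 ?r20.
Qed.

Lemma jet_gen_field f x d0 d1 :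
  jet (fun _ t => f (act t x)) d0 d1 -> gen_field chi act h f x = d1.
Proof.
move=> J; rewrite /gen_field; case: xgetP => [e _ [q [r [r0 E ->]]]|H].
  have J' : jet (fun _ t => f (act t x)) (q.[0] / r.[0])
     ((q^`() * r - q * r^`()).[0] / r.[0] ^+ 2) by exists q, r.
  by case: (jet_uniq J J').
case: J => q [r [r0 E _ E1]]; case: (H d1); exists q, r.
by split=> // s t; apply: E.
Qed.

Lemma jet_poly (q : {poly k}) : jet (fun s _ => q.[s]) q.[0] q^`().[0].
Proof.
exists q, 1; split; rewrite ?hornerC ?oner_neq0 ?divr1 //.
  by move=> s t _ _; rewrite hornerC divr1.
by rewrite expr1n divr1 derivC mulr0 subr0 mulr1.
Qed.

Lemma jet_cst a : jet (fun _ _ => a) a 0.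
Proof.
have := jet_poly a%:P; rewrite derivC horner0 hornerC.
by congr jet; apply: funext => s; rewrite hornerC.
Qed.

Lemma jet_add F G d0 d1 e0 e1 : jet F d0 d1 -> jet G e0 e1 ->
  jet (fun s t => F s t + G s t) (d0 + e0) (d1 + e1).
Proof.
move=> [q [r [r0 E -> ->]]] [q' [r' [r0' E' -> ->]]].
exists (q * r' + q' * r), (r * r'); split; rewrite ?hornerM ?mulf_neq0 //.
- move=> s t st; rewrite !(hornerM, hornerD) mulf_eq0 negb_or => /andP[rs rs'].
  by rewrite E // E' //; field; rewrite ?rs ?rs'.
- by rewrite !(hornerM, hornerD); field; rewrite ?r0 ?r0'.
- by rewrite !(derivM, derivD) !(hornerM, hornerD, hornerN); field; rewrite ?r0 ?r0'.
Qed.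

Lemma jet_mul F G d0 d1 e0 e1 : jet F d0 d1 -> jet G e0 e1 ->
  jet (fun s t => F s t * G s t) (d0 * e0) (d0 * e1 + d1 * e0).
Proof.
move=> [q [r [r0 E -> ->]]] [q' [r' [r0' E' -> ->]]].
exists (q * q'), (r * r'); split; rewrite ?hornerM ?mulf_neq0 //.
- move=> s t st; rewrite !(hornerM, hornerD) mulf_eq0 negb_or => /andP[rs rs'].
  by rewrite E // E' //; field; rewrite ?rs ?rs'.
- by field; rewrite ?r0 ?r0'.
- by rewrite !derivM !(hornerM, hornerD, hornerN); field; rewrite ?r0 ?r0'.
Qed.

Lemma jet_opp F d0 d1 : jet F d0 d1 -> jet (fun s t => - F s t) (- d0) (- d1).
Proof.
move=> J; have := jet_mul (jet_cst (-1)) J.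
rewrite !mulN1r mul0r addr0; congr jet.
by apply: funext => s; apply: funext => t; rewrite mulN1r.
Qed.

Lemma jet_sum (I : Type) (l : seq I) (F : I -> k -> T -> k) (d0 d1 : I -> k) :
  (forall i, jet (F i) (d0 i) (d1 i)) ->
  jet (fun s t => \sum_(i <- l) F i s t) (\sum_(i <- l) d0 i) (\sum_(i <- l) d1 i).
Proof.
move=> FJ; elim: l => [|i l IHl].
  rewrite !big_nil; apply: jet_near (jet_cst 0).
  by exists 1; rewrite hornerC oner_neq0; split=> // s t; rewrite big_nil.
rewrite !big_cons; apply: jet_near (jet_add (FJ i) IHl).
by exists 1; rewrite hornerC oner_neq0; split=> // s t; rewrite big_cons.
Qed.

Lemma jet_inv H h0 h1 : h0 != 0 -> jet H h0 h1 ->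
  jet (fun s t => (H s t)^-1) h0^-1 (- h1 / h0 ^+ 2).
Proof.
move=> h00 [q [r [r0 E E0 ->]]].
have q0 : q.[0] != 0 by apply: contraNneq h00 => Z; rewrite E0 Z mul0r.
exists (r * r), (q * r); split; rewrite ?hornerM ?mulf_neq0 //.
- move=> s t st; rewrite !(hornerM, hornerD) mulf_eq0 negb_or => /andP[qs rs].
  by rewrite E //; field; rewrite ?rs ?qs.
- by rewrite E0; field; rewrite ?r0 ?q0.
- by rewrite E0 !derivM !(hornerM, hornerD, hornerN); field; rewrite ?r0 ?q0.
Qed.

Lemma jet_neq0 H h0 h1 : h0 != 0 -> jet H h0 h1 -> near_curve (fun s t => H s t != 0).
Proof.
move=> h00 [q [r [r0 E E0 _]]].
have q0 : q.[0] != 0 by apply: contraNneq h00 => Z; rewrite E0 Z mul0r.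
exists (q * r); rewrite hornerM mulf_neq0 //; split=> // s t st.
rewrite hornerM mulf_eq0 negb_or => /andP[qs rs].
by rewrite E // mulf_neq0 ?invr_eq0.
Qed.

Lemma jet_div F G H g0 g1 h0 h1 : h0 != 0 ->
  near_curve (fun s t => F s t * H s t = G s t) ->
  jet G g0 g1 -> jet H h0 h1 -> jet F (g0 / h0) ((g1 * h0 - g0 * h1) / h0 ^+ 2).
Proof.
move=> h00 FHG JG JH; have NH := jet_neq0 h00 JH.
have := jet_mul JG (jet_inv h00 JH).
have -> : g0 * (- h1 / h0 ^+ 2) + g1 * h0^-1 = (g1 * h0 - g0 * h1) / h0 ^+ 2.
  by field.
apply: jet_near; apply: near_curveS (near_curveI NH FHG) => s t [Hs <-].
by rewrite mulfK.
Qed.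

(** What a section of the tensor product sheaf becomes along the curve, once denominators in [s] are
    cleared. [G0] and [G1] are the value and the [s]-derivative at 0, as functions of [z]; a jet
    concerns a single [z], whereas here regularity in [z] is kept. *)
Definition pencil (y : X) (G : k -> X -> k) (G0 G1 : X -> k) : Prop :=
  exists (I : finType) (a : I -> {poly k}) (v : I -> X -> k),
  [/\ forall i, regular (v i) y, G = fun s z => \sum_i (a i).[s] * v i z,
      G0 = fun z => \sum_i (a i).[0] * v i z &
      G1 = fun z => \sum_i (a i)^`().[0] * v i z].

Lemma pencil_regular y G G0 G1 : pencil y G G0 G1 ->
  [/\ forall s, regular (G s) y, regular G0 y & regular G1 y].
Proof.
move=> [I [a [v [rv -> -> ->]]]]; split=> [s||]; apply: (regular_sum X_charts) => i _;
  by apply: (regular_mul X_charts) => //; apply: regular_cst.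
Qed.

Lemma pencil_at0 y G G0 G1 : pencil y G G0 G1 -> G0 = G 0.
Proof. by move=> [I [a [v [_ -> ->]]]]. Qed.

Lemma pencil_jet_at y G G0 G1 z : pencil y G G0 G1 ->
  jet (fun s _ => G s z) (G0 z) (G1 z).
Proof.
move=> [I [a [v [_ -> -> ->]]]]; apply: jet_sum => i.
have := jet_mul (jet_poly (a i)) (jet_cst (v i z)).
by rewrite mulr0 add0r.
Qed.

Lemma pencil_mul y F F0 F1 G G0 G1 : pencil y F F0 F1 -> pencil y G G0 G1 ->
  exists H0 H1, pencil y (fun s z => F s z * G s z) H0 H1.
Proof.
move=> [I [a [v [rv -> _ _]]]] [J [b [w [rw -> _ _]]]].
pose c (ij : I * J) := a ij.1 * b ij.2.
pose u (ij : I * J) z := v ij.1 z * w ij.2 z.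
exists (fun z => \sum_ij (c ij).[0] * u ij z), (fun z => \sum_ij (c ij)^`().[0] * u ij z).
exists (I * J)%type, c, u; split=> //.
  by move=> ij; apply: (regular_mul X_charts).
apply: funext => s; apply: funext => z.
rewrite big_distrlr pair_big /=; apply: eq_bigr => ij _.
by rewrite /c /u hornerM mulrACA.
Qed.

Lemma pencil_scale y F F0 F1 (r : {poly k}) : pencil y F F0 F1 ->
  exists H0 H1, pencil y (fun s z => F s z * r.[s]) H0 H1.
Proof.
move=> PF; have P1 : pencil y (fun s _ => \sum_(i : 'I_1) r.[s] * 1)
   (fun=> \sum_(i : 'I_1) r.[0] * 1) (fun=> \sum_(i : 'I_1) r^`().[0] * 1).
  exists 'I_1, (fun=> r), (fun _ _ => 1); split=> // _.
  exact: regular_cst.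
have [H0 [H1 E]] := pencil_mul PF P1; exists H0, H1; move: E; congr pencil.
by apply: funext => s; apply: funext => z; rewrite big_ord1 mulr1.
Qed.

Section AtUnit.
Variable e : T.
Hypothesis e1 : forall i, chi i e = 1.

Lemma curve_mpoly (q : {mpoly k[m]}) :
  exists Q : {poly k}, forall s, Q.[s] = q.@[fun i => 1 + s * h i].
Proof.
elim/mpolyind: q => [|a mm q _ _ [Q QE]].
  by exists 0 => s; rewrite horner0 meval0.
exists (a *: \prod_i (1 + h i *: 'X) ^+ mm i + Q) => s.
rewrite hornerD hornerZ QE mevalD mevalZ mevalX horner_prod; congr (_ * _ + _).
by apply: eq_bigr => i _; rewrite !hornerE mulrC.
Qed.

Lemma curve_regular u : regular u e ->
  exists q r : {poly k}, [/\ r.[0] != 0, u e = q.[0] / r.[0] &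
    near_curve (fun s t => u t = q.[s] / r.[s] /\ r.[s] != 0)].
Proof.
move/(chart_regular _ T_torus I) => [q [r [re E]]].
have chie : chi^~ e = (fun i => 1 + 0 * h i).
  by apply: funext => i; rewrite mul0r addr0.
have [Q QE] := curve_mpoly q; have [R RE] := curve_mpoly r.
have R0 : R.[0] != 0 by rewrite RE -chie.
exists Q, R; split=> //; first by rewrite QE RE -chie (nbhs_singleton E).
have [_ _ _ H _] := T_torus; have /(H _ _ I) [z [z0 zE]] := E.
have [Z ZE] := curve_mpoly z; exists (R * Z); split.
  by rewrite hornerM mulf_neq0 // ZE -chie.
move=> s t st; rewrite hornerM mulf_eq0 negb_or => /andP[Rs Zs]; split=> //.
have chit : chi^~ t = (fun i => 1 + s * h i) by apply: funext.
by rewrite (zE t) // ?QE ?RE ?chit // -ZE.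
Qed.

Lemma curve_nbhs (A : set T) : nbhs e A -> near_curve (fun _ t => A t).
Proof.
have [_ _ _ H _] := T_torus; move/(H _ _ I) => [z [z0 zE]].
have [Z ZE] := curve_mpoly z; exists Z; split.
  rewrite ZE; move: z0; congr (is_true (z.@[_] != 0)).
  by apply: funext => i; rewrite mul0r addr0.
move=> s t st Zs; apply: zE => //.
have -> : (fun i => chi i t) = (fun i => 1 + s * h i) by apply: funext.
by rewrite -ZE.
Qed.

(** Along the curve the factors that live on [T] become fractions in [s]; [r] is the product of
    their denominators. The neighbourhood [B] does not depend on [s]. *)
Lemma tensor_pencil w y : tensor w e y ->
  exists G G0 G1 (r : {poly k}) (B : set X),
    [/\ pencil y G G0 G1, r.[0] != 0, nbhs y B, w e y * r.[0] = G0 y &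
      near_curve (fun s t => r.[s] != 0 /\
        forall z, B z -> w t z * r.[s] = G s z)].
Proof.
move=> [M [u [v [ruv [[A B] /= [Ae By] AB]]]]].
have /choice [q qE] : forall i, exists q : {poly k} * {poly k},
    [/\ q.2.[0] != 0, u i e = q.1.[0] / q.2.[0] &
    near_curve (fun s t => u i t = q.1.[s] / q.2.[s] /\ q.2.[s] != 0)].
  move=> i; have [ru _] := ruv i; have [q [r [r0 E N]]] := curve_regular ru.
  by exists (q, r).
pose r := \prod_i (q i).2.
pose a i := (q i).1 * \prod_(j | j != i) (q j).2.
have r0 : r.[0] != 0.
  by rewrite horner_prod; apply/prodf_neq0 => i _; case: (qE i).
exists (fun s z => \sum_i (a i).[s] * v i z), (fun z => \sum_i (a i).[0] * v i z).
exists (fun z => \sum_i (a i)^`().[0] * v i z), r, B.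
have key s i x : (q i).2.[s] != 0 -> x = (q i).1.[s] / (q i).2.[s] ->
    x * r.[s] = (a i).[s].
  move=> nz ->; rewrite /r /a (bigD1 i) //= !hornerM.
  by rewrite mulrA divfK.
split=> //.
- by exists 'I_M, a, v; split=> // i; case: (ruv i).
- have -> := AB (e, y) (conj (nbhs_singleton Ae) (nbhs_singleton By)).
  rewrite big_distrl /=; apply: eq_bigr => i _.
  by case: (qE i) => q0 Ei _; rewrite mulrAC (key 0 i).
have NA := curve_nbhs Ae.
have : near_curve (fun s t => r.[s] != 0 /\ forall i, u i t * r.[s] = (a i).[s]).
  have : near_curve (fun s t => forall i, u i t = (q i).1.[s] / (q i).2.[s]).
    have /choice [z zE] : forall i, exists z : {poly k}, z.[0] != 0 /\
       forall s t, (forall i, chi i t = 1 + s * h i) -> z.[s] != 0 ->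
         u i t = (q i).1.[s] / (q i).2.[s].
      move=> i; case: (qE i) => _ _ [z [z0 zE]]; exists z; split=> // s t st zs.
      by case: (zE s t st zs).
    exists (\prod_i z i); rewrite horner_prod; split.
      by apply/prodf_neq0 => i _; case: (zE i).
    move=> s t st; rewrite horner_prod => /prodf_neq0 zs i.
    by case: (zE i) => _; apply=> //; apply: zs.
  move=> /near_curveI/(_ (near_curve_poly r0)); apply: near_curveS => s t [E rs].
  split=> // i; apply: key => //; move: rs; rewrite horner_prod => /prodf_neq0.
  exact.
move=> /near_curveI/(_ NA); apply: near_curveS => s t [[rs E] At]; split=> // z Bz.
rewrite (AB (t, z) (conj At Bz)) big_distrl; apply: eq_bigr => i _ /=.
by rewrite mulrAC E.
Qed.

Lemma act_e x : act e x = x.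
Proof. by case: act_T => _ H _; apply: H. Qed.

(** Continuity of the action at [(e, y)] is witnessed by a section [w] with [w e y != 0]; along the
    curve, up to a denominator, [w] becomes a polynomial in [s] that is nonzero at 0. *)
Lemma act_near y (W : set X) : nbhs y W -> near_curve (fun _ t => W (act t y)).
Proof.
move=> Wy; have [/(_ e y) [] + _ _ _] := act_T; rewrite act_e => /(_ W Wy).
move=> [w [tw w0 [[A B] /= [Ae By] AB]]].
have [G [G0 [G1 [r [B' [PG r0 By' E N]]]]]] := tensor_pencil tw.
have G0y : G0 y != 0 by rewrite -E mulf_neq0.
apply: near_curveS (near_curveI (jet_neq0 G0y (pencil_jet_at y PG))
  (near_curveI N (curve_nbhs Ae))) => s t [Gs [[rs Ew] At]].
apply: (AB (t, y)); first by split=> //; apply: nbhs_singleton.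
apply: contraNneq Gs => /= w0'; rewrite -Ew ?w0' ?mul0r //.
exact: nbhs_singleton.
Qed.

Lemma act_pencil f y : regular f y ->
  exists G G0 G1 H H0 H1 (B : set X),
    [/\ pencil y G G0 G1, pencil y H H0 H1, H0 y != 0, nbhs y B &
      near_curve (fun s t => forall z, B z -> H s z != 0 ->
         f (act t z) * H s z = G s z)].
Proof.
move=> rf; have [/(_ e y) [_ +] _ _] := act_T; rewrite act_e => /(_ f rf).
move=> [g [w [tg tw w0 [w2 [tw2 w20 [[A B] /= [Ae By] AB]]]]]].
have [G [G0 [G1 [rg [Bg [PG rg0 Bgy EG NG]]]]]] := tensor_pencil tg.
have [H [H0 [H1 [rh [Bh [PH rh0 Bhy EH NH]]]]]] := tensor_pencil tw.
have [L [L0 [L1 [rl [Bl [PL rl0 Bly EL NL]]]]]] := tensor_pencil tw2.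
have [GL0 [GL1 PGL]] := pencil_mul PG PL.
have [HL0 [HL1 PHL]] := pencil_mul PH PL.
have [N0 [N1 PN]] := pencil_scale rh PGL.
have [D0 [D1 PD]] := pencil_scale rg PHL.
(* The cross factors [rh] and [rg] compensate the denominators cleared from [w] and [g]. The factor
   [L], which comes from [w2], confines [H s z != 0] to the set where the fraction [g / w]
   represents [f]. *)
exists (fun s z => G s z * L s z * rh.[s]), N0, N1.
exists (fun s z => H s z * L s z * rg.[s]), D0, D1, (B `&` (Bg `&` (Bh `&` Bl))).
split=> //.
- rewrite (pencil_at0 PD) -(pencil_at0 PH) -(pencil_at0 PL).
  by rewrite -EH -EL !mulf_neq0.
- by repeat apply: filterI.
apply: near_curveS (near_curveI (curve_nbhs Ae)
   (near_curveI NG (near_curveI NH NL))) => s t [At [[rgs Eg] [[rhs Eh] [rls El]]]].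
move=> z [Bz [Bgz [Bhz Blz]]]; rewrite -Eg // -Eh // -El //.
rewrite !mulf_eq0 !negb_or => /andP[/andP[/andP[wz _] /andP[w2z _]] _].
rewrite (AB (t, z)) //=; field; exact: wz.
Qed.

(** Differentiate [f (act t z) * H = G] at [s = 0]: the generator maps [f] to [(G1 - f * H1) / H0]
    around [y], which gives regularity. The last clause keeps the identity on a neighbourhood of [y]
    for fixed [s], so that a derivation in [z] may be applied to it. *)
Lemma gen_field_spec f y : regular f y ->
  exists G G0 G1 H H0 H1,
    [/\ pencil y G G0 G1, pencil y H H0 H1, H0 y != 0 &
    (\forall z \near y, [/\ H0 z != 0, f z * H0 z = G0 z,
        gen_field chi act h f z * H0 z = G1 z - f z * H1 z &
        jet (fun _ t => f (act t z)) (f z) (gen_field chi act h f z)]) /\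
    near_curve (fun s t => H s y != 0 /\ \forall z \near y,
        f (act t z) * H s z = G s z)].
Proof.
move=> rf; have [G [G0 [G1 [H [H0 [H1 [B [PG PH H0y By N]]]]]]]] := act_pencil rf.
exists G, G0, G1, H, H0, H1; split=> //; split; last first.
  apply: near_curveS (near_curveI N (jet_neq0 H0y (pencil_jet_at y PH))) => s t [E Hs].
  split=> //; have [rH _ _] := pencil_regular PH.
  have NH := near_neq0 X_charts (rH s) Hs.
  by near=> z; apply: E; near: z.
have [_ rH0 _] := pencil_regular PH; have NH := near_neq0 X_charts rH0 H0y.
near=> z; have Bz : B z by near: z.
have Hz : H0 z != 0 by near: z.
have NC : near_curve (fun s t => f (act t z) * H s z = G s z).
  apply: near_curveS (near_curveI N (jet_neq0 Hz (pencil_jet_at z PH))) => s t [E Hs].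
  exact: E.
have J := jet_div Hz NC (pencil_jet_at z PG) (pencil_jet_at z PH).
have fz : f z * H0 z = G0 z.
  case: NC => r [r0 rE]; rewrite (pencil_at0 PH) (pencil_at0 PG).
  by rewrite -(rE 0 e) ?act_e // => i; rewrite e1 mul0r addr0.
have gz := jet_gen_field J; have fz' : f z = G0 z / H0 z by rewrite -fz mulfK.
by split=> //; rewrite gz ?fz' //; field.
Unshelve. all: by end_near. Qed.

Lemma act_regular f y : regular f y ->
  near_curve (fun _ t => regular (fun z => f (act t z)) y).
Proof.
move=> rf; have [G [G0 [G1 [H [H0 [H1 [PG PH H0y [_ N]]]]]]]] := gen_field_spec rf.
have [rG _ _] := pencil_regular PG; have [rH _ _] := pencil_regular PH.
apply: near_curveS N => s t [Hs Ez].
apply: (@regular_local _ _ X_charts _ (fun z => G s z * (H s z)^-1)).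
  have NH := near_neq0 X_charts (rH s) Hs.
  by near=> z; rewrite -(near Ez z) // mulfK //; near: z.
by apply: (regular_mul X_charts) => //; apply: regular_inv.
Unshelve. all: by end_near. Qed.

Lemma gen_field_jet f y : regular f y ->
  jet (fun _ t => f (act t y)) (f y) (gen_field chi act h f y).
Proof.
by move/gen_field_spec => [? [? [? [? [? [? [_ _ _ [/nbhs_singleton [] ]]]]]]]].
Qed.

Lemma gen_field_regular f y : regular f y -> regular (gen_field chi act h f) y.
Proof.
move=> rf; have [G [G0 [G1 [H [H0 [H1 [PG PH H0y [E _]]]]]]]] := gen_field_spec rf.
have [_ rG0 rG1] := pencil_regular PG; have [_ rH0 rH1] := pencil_regular PH.
apply: (@regular_local _ _ X_charts _ (fun z => (G1 z - f z * H1 z) * (H0 z)^-1)).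
  by apply: filterS E => z [Hz _ <- _]; rewrite mulfK.
apply: (regular_mul X_charts); last exact: regular_inv.
by apply: (regular_sub X_charts) => //; apply: (regular_mul X_charts).
Qed.

Lemma gen_field_pder y : pder y (fun f => gen_field chi act h f y).
Proof.
split=> [f g rf fg|c f g rf rg|f g rf rg].
- have N := act_near fg; symmetry; apply: (jet_gen_field (d0 := f y)).
  by apply: jet_near (gen_field_jet rf); apply: near_curveS N.
- apply: (jet_gen_field (d0 := c * f y + g y)).
  have := jet_add (jet_mul (jet_cst c) (gen_field_jet rf)) (gen_field_jet rg).
  by rewrite mul0r addr0.
- apply: (jet_gen_field (d0 := f y * g y)).
  by rewrite [g y * _]mulrC; apply: jet_mul; apply: gen_field_jet.
Qed.

(** * Tangent vectors varying along the curve *)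

Section Transport.
Variables (y : X) (V : k -> T -> (X -> k) -> k) (v w : (X -> k) -> k).
Hypothesis V_pder : near_curve (fun s t => pder y (V s t)).
Hypothesis V_jet : forall f, regular f y -> jet (fun s t => V s t f) (v f) (w f).

(** The rules of a derivation hold for [V s t] for almost all [s]; comparing 1-jets gives them for
    the constant term [v] and for the linear term [w]. *)
Lemma transport_pder : pder y v /\
  [/\ forall f g, regular f y -> (\forall z \near y, f z = g z) -> w f = w g,
      forall c f g, regular f y -> regular g y ->
        w (fun z => c * f z + g z) = c * w f + w g &
      forall f g, regular f y -> regular g y ->
        w (fun z => f z * g z) = f y * w g + g y * w f].
Proof.
have L f g : regular f y -> (\forall z \near y, f z = g z) -> v f = v g /\ w f = w g.
  move=> rf fg; have rg := regular_local X_charts fg rf.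
  apply: jet_uniq (V_jet rf) _; apply: jet_near (V_jet rg).
  apply: near_curveS V_pder => s t pv; symmetry.
  exact: (pder_local pv).
have A c f g : regular f y -> regular g y ->
    v (fun z => c * f z + g z) = c * v f + v g /\
    w (fun z => c * f z + g z) = c * w f + w g.
  move=> rf rg.
  have r : regular (fun z => c * f z + g z) y.
    apply: (regular_add X_charts) => //; apply: (regular_mul X_charts) => //.
    exact: regular_cst.
  have := jet_add (jet_mul (jet_cst c) (V_jet rf)) (V_jet rg).
  rewrite mul0r addr0; apply: jet_uniq.
  apply: jet_near (V_jet r); apply: near_curveS V_pder => s t [_ H _].
  by rewrite H.
have M f g : regular f y -> regular g y ->
    v (fun z => f z * g z) = f y * v g + g y * v f /\
    w (fun z => f z * g z) = f y * w g + g y * w f.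
  move=> rf rg.
  have r : regular (fun z => f z * g z) y by apply: (regular_mul X_charts).
  have := jet_add (jet_mul (jet_cst (f y)) (V_jet rg)) (jet_mul (jet_cst (g y)) (V_jet rf)).
  rewrite !mul0r !addr0; apply: jet_uniq.
  apply: jet_near (V_jet r); apply: near_curveS V_pder => s t pv.
  by rewrite (pderM pv).
split; split=> [f g rf fg|c f g rf rg|f g rf rg].
- by case: (L f g rf fg).
- by case: (A c f g rf rg).
- by case: (M f g rf rg).
- by case: (L f g rf fg).
- by case: (A c f g rf rg).
- by case: (M f g rf rg).
Qed.

Lemma pencil_jet G G0 G1 : pencil y G G0 G1 ->
  jet (fun s t => V s t (G s)) (v G0) (v G1 + w G0).
Proof.
move=> [I [a [u [ru -> -> ->]]]]; have [pv pw] := transport_pder.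
have rau (b : I -> k) i : regular (fun z => b i * u i z) y.
  by apply: (regular_mul X_charts) => //; apply: regular_cst.
have lin v' (b : I -> k) : pder y v' ->
    v' (fun z => \sum_i b i * u i z) = \sum_i b i * v' (u i).
  move=> pv'; rewrite (pder_sum X_charts pv') //.
  by apply: eq_bigr => i _; rewrite (pderZ X_charts pv').
rewrite !lin // -big_split /=.
have J i : jet (fun s t => (a i).[s] * V s t (u i)) ((a i).[0] * v (u i))
    ((a i)^`().[0] * v (u i) + (a i).[0] * w (u i)).
  by rewrite addrC; apply: jet_mul; [exact: jet_poly|apply: V_jet].
apply: jet_near (jet_sum (index_enum I) J).
by apply: near_curveS V_pder => s t pv'; rewrite lin.
Qed.

(** The product rule for a varying tangent vector applied to a varying function. The two
    differentiations are exchanged by writing [f (act t z) * H = G] with pencils, on which [V s t]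
    acts term by term. *)
Lemma transport_jet f : regular f y ->
  jet (fun s t => V s t (fun z => f (act t z))) (v f)
      (w f + v (gen_field chi act h f)).
Proof.
move=> rf.
have [G [G0 [G1 [H [H0 [H1 [PG PH H0y [E N]]]]]]]] := gen_field_spec rf.
have [rG rG0 rG1] := pencil_regular PG; have [rH rH0 rH1] := pencil_regular PH.
have [pv pw] := transport_pder.
have rgf := gen_field_regular rf.
have [_ fy gy fJ] := nbhs_singleton E.
have vG0 : v G0 = f y * v H0 + H0 y * v f.
  rewrite -(pderM pv) //; symmetry; apply: (pder_local pv).
    exact: (regular_mul X_charts).
  by apply: filterS E => z [].
have wG0 : w G0 = f y * w H0 + H0 y * w f.
  rewrite -(pderM pw) //; symmetry; apply: (pder_local pw).
    exact: (regular_mul X_charts).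
  by apply: filterS E => z [].
have rfH1 : regular (fun z => f z * H1 z) y by apply: (regular_mul X_charts).
have rgH0 : regular (fun z => gen_field chi act h f z * H0 z) y.
  by apply: (regular_mul X_charts).
have vG1 : v G1 = gen_field chi act h f y * v H0 + H0 y * v (gen_field chi act h f)
    + (f y * v H1 + H1 y * v f).
  rewrite -(pderM pv) // -(pderM pv) // -(pderD pv) //; symmetry.
  apply: (pder_local pv); first exact: (regular_add X_charts).
  by apply: filterS E => z [_ _ -> _]; rewrite subrK.
have JH := pencil_jet_at y PH.
have NC : near_curve (fun s t => V s t (fun z => f (act t z)) * H s y =
    V s t (G s) - f (act t y) * V s t (H s)).
  apply: near_curveS (near_curveI (act_regular rf) (near_curveI V_pder N))
    => s t [rft [pV [Hs Ez]]].
  have <- : V s t (fun z => f (act t z) * H s z) = V s t (G s).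
    by apply: (pder_local pV) => //; apply: (regular_mul X_charts).
  by rewrite (pderM pV) //; ring.
have JN := jet_add (pencil_jet PG) (jet_opp (jet_mul fJ (pencil_jet PH))).
have := jet_div H0y NC JN JH; congr (jet _ _ _).
  by rewrite vG0; field.
by rewrite vG1 wG0 vG0; field.
Qed.

End Transport.

(** A constant family in [transport_jet], namely the tangent vector of [D] at [y]; by invariance its
    value on the translate of [f] by [t] is [D f (act t y)]. *)
Lemma gen_field_invariant (D : (X -> k) -> X -> k) f y :
  (forall g z, regular g z -> regular (D g) z) ->
  pder y (fun g => D g y) ->
  (forall t g, D (fun z => g (act t z)) y = D g (act t y)) ->
  regular f y ->
  gen_field chi act h (D f) y = D (gen_field chi act h f) y.
Proof.
move=> rD pD Dinv rf.
have := @transport_jet y (fun _ _ g => D g y) (fun g => D g y) (fun=> 0) _ _ f rf.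
rewrite add0r => J; apply: (jet_gen_field (d0 := D f y)).
apply: jet_near (J _ _).
- by exists 1; rewrite hornerC oner_neq0.
- by exists 1; rewrite hornerC oner_neq0.
by move=> g rg; apply: jet_cst.
Qed.

End AtUnit.

End Curve.

Lemma torus_unit : exists e, forall i, chi i e = 1.
Proof. by apply: torus_point => i; apply: oner_neq0. Qed.

Lemma gen_field_vfield h U : vfield U (gen_field chi act h).
Proof.
have [e e1] := torus_unit; move=> x _; split=> [f|].
  exact: (gen_field_regular h e1).
exact: (gen_field_pder h e1).
Qed.

Lemma gen_field_comm h h' f y : regular f y ->
  gen_field chi act h (gen_field chi act h' f) y =
  gen_field chi act h' (gen_field chi act h f) y.
Proof.
have [e e1] := torus_unit; move=> rf.
apply: (@gen_field_invariant h e e1 (gen_field chi act h')) => //.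
- by move=> g z; apply: (gen_field_regular h' e1).
- exact: (gen_field_pder h' e1).
- by move=> t g; rewrite gen_field_act.
Qed.

Section Bracket.
Variable pi : op X 2.
Hypothesis pi_vector : polyvector setT pi.

Lemma bracket_pder_l b x : regular b x -> pder x (fun a => bracket pi a b x).
Proof.
move=> rb; pose a0 := fun i : 'I_2 => b.
have := polyvector_pder ord0 pi_vector I (a := a0) (x := x) (fun=> rb).
by congr pder; apply: funext => f; congr (pi _ x); apply: funext => i.
Qed.

Lemma bracket_pder_r a x : regular a x -> pder x (fun b => bracket pi a b x).
Proof.
move=> ra; pose a0 := fun i : 'I_2 => a.
have := polyvector_pder (inord 1) pi_vector I (a := a0) (x := x) (fun=> ra).
congr pder; apply: funext => f; congr (pi _ x); apply: funext => i /=.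
by case: i => [[|[|]]] // Hi; rewrite -!val_eqE /= inordK.
Qed.

Lemma bracket_regular a b x :
  regular a x -> regular b x -> regular (bracket pi a b) x.
Proof.
move=> ra rb; apply: (polyvector_regular pi_vector) => // i.
by case: ifP.
Qed.

Lemma bracket_alt a x : regular a x -> bracket pi a a x = 0.
Proof.
move=> ra; apply: (polyvector_alt (i := ord0) (j := ord_max) pi_vector) => // i.
by case: ifP.
Qed.

Hypothesis act_poisson : acts_by_poisson act pi.

(** Two applications of [transport_jet], one for each argument: the first gives the jet of the
    bracket of the translate of [a] with a fixed [g], and this bracket is the varying tangent vector
    of the second. As [T] preserves [pi], the result is the derivative of [{a, b}] along the orbit
    of [y]. *)
Lemma gen_field_bracket h a b y : regular a y -> regular b y ->
  gen_field chi act h (bracket pi a b) y =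
  bracket pi (gen_field chi act h a) b y + bracket pi a (gen_field chi act h b) y.
Proof.
have [e e1] := torus_unit; move=> ra rb.
pose at_ t := fun z => a (act t z).
have rat : near_curve h (fun _ t => regular (at_ t) y) by apply: act_regular.
have J1 g : regular g y -> jet h (fun _ t => bracket pi (at_ t) g y)
    (bracket pi a g y) (bracket pi (gen_field chi act h a) g y).
  move=> rg; have := @transport_jet h e e1 y (fun _ _ f => bracket pi f g y)
    (fun f => bracket pi f g y) (fun=> 0) _ _ a ra.
  rewrite add0r; apply.
    by exists 1; rewrite hornerC oner_neq0; split=> // *; apply: bracket_pder_l.
  by move=> f rf; apply: jet_cst.
have := @transport_jet h e e1 y (fun _ t f => bracket pi (at_ t) f y)
    (fun f => bracket pi a f y) (fun f => bracket pi (gen_field chi act h a) f y)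
    _ J1 b rb.
move=> J; apply: (jet_gen_field (d0 := bracket pi a b y)).
apply: jet_near (J _); last first.
  by apply: near_curveS rat => s t; apply: bracket_pder_r.
have Na := act_near h e1 (near_regular X_charts ra).
have Nb := act_near h e1 (near_regular X_charts rb).
by apply: near_curveS (near_curveI Na Nb) => s t [rat' rbt]; apply: act_poisson.
Qed.

End Bracket.

End TorusDerivations.

(** * Symplectic bases *)

Section SymplecticBasis.
Variable k : fieldType.
Hypothesis k2 : (2 : k) != 0.

(* the Gram matrix of [r] hyperbolic pairs [(e_0, e_1), (e_2, e_3), ...]
   followed by vectors of the radical *)
Definition hyperbolic (r i j : nat) : k :=
  if [&& i < r.*2, j < r.*2 & i./2 == j./2]%N
  then (i < j)%:R - (j < i)%:R else 0.

Lemma hyperbolicSS r i j : hyperbolic r.+1 i.+2 j.+2 = hyperbolic r i j.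
Proof. by rewrite /hyperbolic doubleS !ltnS /= eqSS. Qed.

Lemma antisym_congr n (A M : 'M[k]_n) : A^T = - A ->
  (M *m A *m M^T)^T = - (M *m A *m M^T).
Proof. by move=> AT; rewrite !trmx_mul trmxK AT !mulNmx mulmxN mulmxA. Qed.

Lemma antisym_diag n (A : 'M[k]_n) i : A^T = - A -> A i i = 0.
Proof.
move=> /matrixP/(_ i i); rewrite !mxE => /eqP; rewrite -subr_eq0 opprK -mulr2n.
by rewrite -mulr_natl mulf_eq0 (negPf k2) => /eqP.
Qed.

Lemma det_mx22 (A : 'M[k]_2) : \det A = A 0 0 * A 1 1 - A 0 1 * A 1 0.
Proof.
rewrite (expand_det_row _ 0) !big_ord_recl big_ord0 addr0 /cofactor !det_mx11.
rewrite !mxE /= !expr0 expr1 mul1r mulN1r mulrN.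
by congr (_ * A _ _ - A _ _ * A _ _); apply: val_inj.
Qed.

(** The block [K] of the first two vectors is invertible. [S] scales the first vector to make the
    pair hyperbolic, and [Y] removes from the other vectors their components along the pair, which
    leaves the Schur complement [Y *m B + D0]. *)
Lemma symplectic_step n (A : 'M[k]_n.+2) : A^T = - A -> A 0 1 != 0 ->
  exists (M : 'M[k]_n.+2) (D : 'M[k]_n), [/\ M \in unitmx, D^T = - D &
    M *m A *m M^T = block_mx (\matrix_(i < 2, j < 2) hyperbolic 1 i j) 0 0 D
      :> 'M[k]_(2 + n)].
Proof.
move=> AT c0; pose c := A 0 1.
pose A' : 'M[k]_(2 + n) := A.
pose K : 'M[k]_2 := ulsubmx A'; pose B := ursubmx A'; pose D0 := drsubmx A'.
have AT' : A'^T = - A' by [].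
have KT : K^T = - K by rewrite /K trmx_ulsub AT'; apply/matrixP => i j; rewrite !mxE.
have BT : B^T = - dlsubmx A' by rewrite /B trmx_ursub AT'; apply/matrixP => i j; rewrite !mxE.
have DT : D0^T = - D0 by rewrite /D0 trmx_drsub AT'; apply/matrixP => i j; rewrite !mxE.
pose S : 'M[k]_2 := \matrix_(i < 2, j < 2) ((i == j)%:R * (if i == 0 then c^-1 else 1)).
have K01 : K 0 1 = c by rewrite !mxE; congr (A _ _); apply: val_inj.
have K10 : K 1 0 = - c by have /matrixP/(_ 0 1) := KT; rewrite mxE [RHS]mxE K01.
have KE : K = \matrix_(i, j) (if i == j then 0 else if i == 0 then c else - c).
  apply/matrixP => i j; rewrite [RHS]mxE; case: eqVneq => [->|].
    exact: antisym_diag.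
  case: i => [[|[|]]] // i2; case: j => [[|[|]]] // j2 _ /=.
    by rewrite -K01; congr (K _ _); apply: val_inj.
  by rewrite -K10; congr (K _ _); apply: val_inj.
have uK : K \in unitmx.
  by rewrite unitmxE KE det_mx22 !mxE /= unitfE mul0r sub0r mulrN opprK mulf_neq0.
pose Y := B^T *m invmx K.
have YK : Y *m K = B^T by rewrite mulmxKV.
have KY : K *m Y^T = - B.
  by rewrite -[K]trmxK KT linearN mulNmx -trmx_mul YK trmxK.
exists (block_mx S 0 Y 1%:M : 'M_(2 + n)), (Y *m B + D0); split.
- rewrite unitmxE (@det_lblock _ 2 n) det1 mulr1 det_mx22 !mxE /=.
  by rewrite !mul1r mulr1 !mul0r subr0 unitfE mulr1 invr_eq0.
- rewrite linearD /= DT trmx_mul -YK -mulmxA KY mulmxN opprD.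
  by [].
pose N : 'M[k]_(2 + n) := block_mx S 0 Y 1%:M.
suff : N *m A' *m N^T =
    block_mx (\matrix_(i < 2, j < 2) hyperbolic 1 i j) 0 0 (Y *m B + D0) by [].
rewrite -[A']submxK /N tr_block_mx !mulmx_block.
rewrite -/K -/B -/D0 !trmx0 !trmx1 !mul0mx !mulmx0 !mul1mx !mulmx1 !addr0.
rewrite -[dlsubmx A']opprK -BT YK addrN !mul0mx add0r.
rewrite -[S *m K *m Y^T]mulmxA KY mulmxN addNr; congr (block_mx _ 0 0 _).
apply/matrixP => i j; rewrite mxE KE.
case: i => [[|[|]]] // i2; case: j => [[|[|]]] // j2;
  rewrite /hyperbolic /= !mxE !big_ord_recl !big_ord0 !mxE !big_ord_recl !big_ord0 !mxE /=;
  by field.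
Qed.

Lemma symplectic_basis n (A : 'M[k]_n) : A^T = - A ->
  exists (M : 'M[k]_n) (r : nat), [/\ M \in unitmx, (r.*2 <= n)%N &
    forall i j, (M *m A *m M^T) i j = hyperbolic r i j].
Proof.
elim/ltn_ind: n A => n IHn A AT.
have [->|] := eqVneq A 0.
  exists 1%:M, 0%N; split=> [||i j]; rewrite ?unitmx1 //.
  by rewrite mulmx0 mul0mx mxE /hyperbolic.
case/matrix0Pn => i [j Aij].
have ij : i != j by apply: contraNneq Aij => ->; rewrite antisym_diag.
case: n IHn A AT i j Aij ij => [|[|n]] IHn A AT i j Aij ij.
- by case: i {Aij ij}.
- by move: ij; rewrite !ord1 eqxx.
have [s [s0 s1]] : exists s : 'S_n.+2, s 0 = i /\ s 1 = j.
  (* The left factor acts first: [1] goes to the preimage of [j] under the transposition of [0] and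
     [i], and from there to [j], while [0] is left to the second factor. *)
  exists (tperm 1%R (tperm 0%R i j) * tperm 0%R i)%g.
  have neq : tperm 0 i j != 0.
    by apply: contraNneq ij => /(congr1 (tperm 0 i)); rewrite tpermK tpermL => ->.
  by split; rewrite permM ?(tpermD _ neq) ?tpermL ?tpermK.
pose P : 'M[k]_n.+2 := perm_mx s.
have PA a b : (P *m A *m P^T) a b = A (s a) (s b).
  by rewrite /P tr_perm_mx -col_permE -row_permE !mxE.
have [M [D [uM DT ME]]] : exists (M : 'M[k]_n.+2) (D : 'M[k]_n),
    [/\ M \in unitmx, D^T = - D &
    M *m (P *m A *m P^T) *m M^T =
    block_mx (\matrix_(i < 2, j < 2) hyperbolic 1 i j) 0 0 D :> 'M[k]_(2 + n)].
  by apply: symplectic_step; [exact: antisym_congr|rewrite PA s0 s1].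
have [M' [r [uM' rn M'E]]] := IHn n (leqW (leqnn _)) D DT.
pose L : 'M[k]_(2 + n) := block_mx 1%:M 0 0 M'.
exists (L *m M *m P), r.+1; split.
- rewrite !unitmx_mul uM unitmx_perm !andbT unitmxE /L.
  by rewrite (@det_lblock _ 2 n) det1 mul1r -unitmxE.
- by rewrite doubleS !ltnS.
move=> a b.
have -> : L *m M *m P *m A *m (L *m M *m P)^T = L *m (M *m (P *m A *m P^T) *m M^T) *m L^T.
  by rewrite !trmx_mul !mulmxA.
pose J : 'M[k]_2 := \matrix_(i < 2, j < 2) hyperbolic 1 i j.
have key : L *m block_mx J 0 0 D *m L^T = block_mx J 0 0 (M' *m D *m M'^T).
  rewrite /L tr_block_mx !mulmx_block !trmx0 !trmx1 !mulmx0 !mul0mx !addr0 !add0r.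
  by rewrite !mul1mx ?mulmx1 !mul0mx.
rewrite ME -/J; apply: etrans (congr1 (fun Z : 'M_(2 + n) => Z a b) key) _.
rewrite -[a](@splitK 2 n) -[b](@splitK 2 n).
case: (@fintype.split 2 n a) => a'; case: (@fintype.split 2 n b) => b' /=.
- rewrite block_mxEul mxE /=; case: a' => [[|[]]] // ?; case: b' => [[|[]]] //.
- rewrite block_mxEur mxE /hyperbolic /=.
  by case: a' => [[|[]]] //= _; rewrite andbF.
- rewrite block_mxEdl mxE /hyperbolic /=.
  by case: b' => [[|[]]] //= _; rewrite !andbF.
- by rewrite block_mxEdr M'E /= add2n hyperbolicSS.
Qed.

End SymplecticBasis.

(** * Divided powers of a bivector in a symplectic basis *)

Section PfaffianTerms.

Lemma increasing_id r (f : 'I_r -> 'I_r) :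
  (forall i j : 'I_r, (i < j)%N -> (f i < f j)%N) -> forall i, f i = i.
Proof.
have ge (g : 'I_r -> 'I_r) : (forall i j : 'I_r, (i < j)%N -> (g i < g j)%N) ->
    forall i : 'I_r, (i <= g i)%N.
  move=> gi [i]; elim: i => [|i IHi] ir //.
  apply: leq_ltn_trans (IHi (ltnW ir)) _.
  exact: gi.
move=> fi i; apply/val_inj/eqP; rewrite eqn_leq (ge f) // andbT.
have := ge (fun j => rev_ord (f (rev_ord j))) _ (rev_ord i).
rewrite rev_ordK /= leq_sub2lE // ltnS; apply => a b ab /=.
by rewrite ltn_sub2lE // ltnS fi //= ltn_sub2lE // ltnS.
Qed.

Lemma pair_ord_half r b (i : 'I_r) : (pair_ord b i)./2 = i.
Proof. by rewrite /= half_bit_double. Qed.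

Lemma pair_ord_odd r b (i : 'I_r) : odd (pair_ord b i) = b.
Proof. by rewrite /= oddD odd_double oddb addbF. Qed.

Lemma pair_ordP r (j : 'I_r.*2) : exists b (i : 'I_r), j = pair_ord b i.
Proof.
have jr : (j./2 < r)%N by rewrite ltn_half_double.
by exists (odd j), (Ordinal jr); apply: val_inj; rewrite /= odd_double_half.
Qed.

Variables (k : closedFieldType) (X : kspace k) (pi : op X 2) (y : X).

(** Only the identity permutation contributes. A nonzero term must match the indices [2 i] and
    [2 i + 1]; the order inside the pairs and between the pairs then leaves no choice. *)
Lemma div_pow_hyperbolic r (a : 'I_r.*2 -> X -> k) :
  (forall i j, bracket pi (a i) (a j) y = hyperbolic k r i j) ->
  div_pow pi r a y = 1.
Proof.
move=> aE; rewrite /div_pow (bigD1 1%g) /=; last first.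
  apply/andP; split.
    apply/forallP => i; apply/forallP => j; apply/implyP => ij.
    by rewrite !perm1 /= !add0n ltn_double.
  by apply/forallP => i; rewrite !perm1.
rewrite odd_perm1 expr0 mul1r big1 => [|i _]; last first.
  rewrite aE !perm1 /hyperbolic !ltn_ord !pair_ord_half eqxx /=.
  by rewrite add1n add0n ltnS leqnn ltnNge leqnSn subr0.
rewrite big1 ?addr0 // => s /andP[/andP[/forallP incr /forallP pairs] s1].
have {}incr (i j : 'I_r) : (i < j)%N -> (s (pair_ord false i) < s (pair_ord false j))%N.
  by have /forallP/(_ j)/implyP := incr i.
apply/eqP; rewrite mulf_eq0 signr_eq0 /=.
apply: contraNT s1 => /prodf_neq0 nz.
have halves i : (s (pair_ord false i))./2 = (s (pair_ord true i))./2.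
  have := nz i isT; rewrite aE /hyperbolic.
  by case: ifP => [/and3P[_ _ /eqP]|]; rewrite ?eqxx.
have parity i : odd (s (pair_ord false i)) = false /\ odd (s (pair_ord true i)).
  have := pairs i; rewrite -[X in (X < _)%N]odd_double_half.
  rewrite -[X in (_ < X)%N]odd_double_half halves.
  by do 2!case: odd; rewrite // ?ltnn // add1n add0n ltnNge leqnSn.
have hr i : ((s (pair_ord false i))./2 < r)%N by rewrite ltn_half_double ltn_ord.
pose f i := Ordinal (hr i).
have fE b i : s (pair_ord b i) = pair_ord b (f i).
  apply: val_inj; rewrite -[LHS]odd_double_half /=; have [e o] := parity i.
  by case: b; rewrite ?o ?e -?halves.
have fid : forall i, f i = i.
  apply: increasing_id => i j /incr; rewrite !fE /= !add0n ltn_double.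
  by [].
apply/eqP/permP => j; have [b [i ->]] := pair_ordP j.
by rewrite fE fid perm1.
Qed.

Lemma div_pow_radical r (a : 'I_r.*2 -> X -> k) j :
  (forall i, bracket pi (a i) (a j) y = 0 /\ bracket pi (a j) (a i) y = 0) ->
  div_pow pi r a y = 0.
Proof.
move=> aj; rewrite /div_pow big1 // => s _.
have [b [i E]] := pair_ordP ((s^-1)%g j).
have {}E : j = s (pair_ord b i) by rewrite -E permKV.
rewrite (bigD1 i) //=; case: b E => <-.
  by case: (aj (s (pair_ord false i))) => -> _; rewrite mul0r mulr0.
by case: (aj (s (pair_ord true i))) => _ ->; rewrite mul0r mulr0.
Qed.

(** Counting: a nonzero value of [pi^[r]] involves no radical vector, so its [2 r] distinct indices
    lie below [2 q <= 2 r] and exhaust them, which leaves only radical vectors for the other [l]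
    arguments. *)
Lemma div_pow_left r q l (a : 'I_(r.*2 + l) -> X -> k) (s : 'S_(r.*2 + l)) :
  (forall i j, bracket pi (a i) (a j) y = hyperbolic k q i j) -> (q <= r)%N ->
  div_pow pi r (fun i => a (s (lshift l i))) y != 0 ->
  forall j : 'I_l, (q.*2 <= s (rshift r.*2 j))%N.
Proof.
move=> aE qr nz j; rewrite leqNgt; apply/negP => sj.
have left i : (s (lshift l i) < q.*2)%N.
  rewrite ltnNge; apply: contra nz => qi; apply/eqP/(@div_pow_radical _ _ i) => i'.
  by rewrite !aE /hyperbolic [(s (lshift l i) < _)%N]ltnNge qi /= andbF.
pose e := [seq val (s (lshift l i)) | i <- enum 'I_r.*2].
have ue : uniq (val (s (rshift r.*2 j)) :: e).
  rewrite /= map_inj_uniq ?enum_uniq ?andbT => [|i i' /val_inj/perm_inj/lshift_inj //].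
  apply/mapP => -[i _] /val_inj/perm_inj/eqP.
  by rewrite eq_rlshift.
have sub : {subset val (s (rshift r.*2 j)) :: e <= iota 0 q.*2}.
  move=> x; rewrite inE mem_iota => /orP[/eqP -> //|/mapP[i _ ->]].
  exact: left.
have := uniq_leq_size ue sub.
by rewrite /= size_map size_enum_ord size_iota ltnNge leq_double qr.
Qed.

End PfaffianTerms.

(** * Lie derivatives *)

Section LieDerivative.
Variables (k : closedFieldType) (X : kspace k).
Hypothesis X_charts : has_charts X.
Variables (U : set X) (D : (X -> k) -> X -> k).
Hypothesis oU : open U.
Hypothesis D_U : vfield U D.

Definition lie m (P : op X m) : op X m := fun a x =>
  D (P a) x - \sum_j P [eta a with j |-> D (a j)] x.

Let regD f x : U x -> regular f x -> regular (D f) x.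
Proof. by move=> Ux; case: (D_U Ux) => H _; apply: H. Qed.

Let pderU x : U x -> pder x (fun f => D f x).
Proof. by move=> Ux; case: (D_U Ux). Qed.

Lemma vfield_local f g x : U x -> regular f x ->
  (\forall y \near x, f y = g y) -> \forall y \near x, D f y = D g y.
Proof.
move=> Ux rf fg; have fg' : \forall z \near x, \forall y \near z, f y = g y.
  exact: nbhs_interior.
have Rf := near_regular X_charts rf.
have NU : \forall y \near x, U y by apply: open_nbhs_nbhs.
near=> y; have Uy : U y by near: y.
by apply: (pder_local (pderU Uy)); near: y.
Unshelve. all: by end_near. Qed.

Section Multiderivation.
Variables (m : nat) (P : op X m).
Hypothesis P_U : polyvector U P.

Lemma lie_upd (a : 'I_m -> X -> k) i f x :
  lie P [eta a with i |-> f] x = D (P [eta a with i |-> f]) x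
    - (P [eta a with i |-> D f] x
       + \sum_(j | j != i) P [eta [eta a with j |-> D (a j)] with i |-> f] x).
Proof.
rewrite /lie (bigD1 i) //=; congr (_ - (_ + _)).
  by congr (P _ x); apply: funext => j /=; rewrite eqxx; case: eqP.
apply: eq_bigr => j ji; rewrite (negPf ji); congr (P _ x); apply: funext => l /=.
by case: (eqVneq l j) => [->|//]; rewrite (negPf ji).
Qed.

(** [lie P] is a commutator of [D] with [P]: in the product rule the mixed terms, with [D] on one
    factor and [P] on the other, occur once with each sign and cancel. *)
Lemma lie_pder x a i : U x -> (forall j, regular (a j) x) ->
  pder x (fun f => lie P [eta a with i |-> f] x).
Proof.
move=> Ux ra; have pD := pderU Ux.
pose A f := P [eta a with i |-> f].
have rA f : regular f x -> regular (A f) x.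
  by move=> rf; apply: (polyvector_regular P_U Ux); apply: regular_upd.
have NU : \forall y \near x, U y by apply: open_nbhs_nbhs.
have Ra : \forall y \near x, forall j, regular (a j) y.
  by apply: filter_forall => j; apply: (near_regular X_charts).
have pA : \forall y \near x, pder y (fun f => A f y).
  near=> y; apply: (polyvector_pder _ P_U); first by near: y.
  by near: y.
have pAx := nbhs_singleton pA.
pose B j f := P [eta [eta a with j |-> D (a j)] with i |-> f] x.
have pB j : pder x (B j).
  apply: (polyvector_pder _ P_U) => //; apply: regular_upd => //.
  exact: regD.
have E f : lie P [eta a with i |-> f] x =
    D (A f) x - (A (D f) x + \sum_(j | j != i) B j f) by rewrite lie_upd.
split=> [f g rf fg|c f g rf rg|f g rf rg]; rewrite !E.
- have fg' : \forall z \near x, \forall y \near z, f y = g y by apply: nbhs_interior.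
  have Rf := near_regular X_charts rf.
  congr (_ - (_ + _)); last first.
  + by apply: eq_bigr => j _; apply: (pder_local (pB j)).
  + apply: (pder_local pAx); first exact: regD.
    exact: vfield_local.
  apply: (pder_local pD); first exact: rA.
  near=> y; have py : pder y (fun f => A f y) by near: y.
  by apply: (pder_local py); near: y.
- have r0 : regular (fun y => c * f y + g y) x.
    apply: (regular_add X_charts) => //; apply: (regular_mul X_charts) => //.
    exact: regular_cst.
  have -> : D (A (fun y => c * f y + g y)) x = c * D (A f) x + D (A g) x.
    rewrite -(pder_lin pD); [|exact: rA|exact: rA].
    apply: (pder_local pD); first exact: rA.
    have Rf := near_regular X_charts rf; have Rg := near_regular X_charts rg.
    near=> y; have py : pder y (fun f => A f y) by near: y.
    by rewrite (pder_lin py); [|near: y|near: y].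
  have -> : A (D (fun y => c * f y + g y)) x = c * A (D f) x + A (D g) x.
    rewrite -(pder_lin pAx); [|exact: regD|exact: regD].
    apply: (pder_local pAx); first exact: regD.
    have Rf := near_regular X_charts rf; have Rg := near_regular X_charts rg.
    near=> y; have Uy : U y by near: y.
    by rewrite (pder_lin (pderU Uy)); [|near: y|near: y].
  under eq_bigr => j _ do rewrite (pder_lin (pB j) _ rf rg).
  by rewrite big_split -big_distrr /=; ring.
- have r0 : regular (fun y => f y * g y) x by apply: (regular_mul X_charts).
  have Rf := near_regular X_charts rf; have Rg := near_regular X_charts rg.
  have -> : D (A (fun y => f y * g y)) x =
      f x * D (A g) x + A g x * D f x + (g x * D (A f) x + A f x * D g x).
    rewrite -(pderM pD) //; last exact: rA.
    rewrite -(pderM pD) //; last exact: rA.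
    have rAf := rA f rf; have rAg := rA g rg.
    rewrite -(pderD pD); try exact: (regular_mul X_charts).
    apply: (pder_local pD); first exact: rA.
    near=> y; have py : pder y (fun f => A f y) by near: y.
    by rewrite (pderM py); [|near: y|near: y].
  have -> : A (D (fun y => f y * g y)) x =
      f x * A (D g) x + D g x * A f x + (g x * A (D f) x + D f x * A g x).
    have rDf := regD Ux rf; have rDg := regD Ux rg.
    rewrite -(pderM pAx) // -(pderM pAx) // -(pderD pAx);
      try exact: (regular_mul X_charts).
    apply: (pder_local pAx); first exact: regD.
    near=> y; have Uy : U y by near: y.
    by rewrite (pderM (pderU Uy)); [|near: y|near: y].
  under eq_bigr => j _ do rewrite (pderM (pB j) rf rg).
  by rewrite big_split -!big_distrr /=; ring.
Unshelve. all: by end_near. Qed.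

Lemma polyvector_antisym x a i j u w : U x -> (forall l, regular (a l) x) ->
  i != j -> regular u x -> regular w x ->
  P [eta [eta a with i |-> u] with j |-> w] x =
  - P [eta [eta a with i |-> w] with j |-> u] x.
Proof.
move=> Ux ra ij ru rw.
pose H f g := P [eta [eta a with i |-> f] with j |-> g] x.
have C f g : H f g = P [eta [eta a with j |-> g] with i |-> f] x.
  congr (P _ x); apply: funext => l /=; case: (eqVneq l j) => // ->.
  by rewrite eq_sym (negPf ij).
have HE f : regular f x -> H f f = 0.
  move=> rf; apply: (polyvector_alt (i := i) (j := j) P_U Ux) => //.
    by do 2!apply: regular_upd => //.
  by rewrite /= eqxx (negPf ij) eqxx.
have Hr f : regular f x -> pder x (H f).
  by move=> rf; apply: (polyvector_pder _ P_U) => //; apply: regular_upd.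
have Hl g : regular g x -> pder x (H^~ g).
  move=> rg; have : pder x (fun f => P [eta [eta a with j |-> g] with i |-> f] x).
    by apply: (polyvector_pder _ P_U) => //; apply: regular_upd.
  by congr pder; apply: funext => f; rewrite C.
have ruw : regular (fun y => u y + w y) x by apply: (regular_add X_charts).
have := HE _ ruw; rewrite (pderD (Hr _ ruw)) // (pderD (Hl u ru)) //.
rewrite (pderD (Hl w rw)) // !HE // addr0 add0r => /eqP.
by rewrite addr_eq0 -/(H w u) => /eqP ->; rewrite opprK.
Qed.

(** The terms with [D] in a position other than [i] and [j] still have two equal arguments; the
    remaining two cancel by antisymmetry. *)
Lemma lie_alt x a i j : U x -> (forall l, regular (a l) x) ->
  i != j -> a i = a j -> lie P a x = 0.
Proof.
move=> Ux ra ij E; have ji : j != i by rewrite eq_sym.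
have NU : \forall y \near x, U y by apply: open_nbhs_nbhs.
have Ra : \forall y \near x, forall j, regular (a j) y.
  by apply: filter_forall => l; apply: (near_regular X_charts).
have -> : lie P a x = D (P a) x - (P [eta a with i |-> D (a i)] x
     + P [eta a with j |-> D (a j)] x).
  rewrite /lie (bigD1 i) //= (bigD1 j) //= big1 ?addr0 // => l /andP[li lj].
  apply: (polyvector_alt (i := i) (j := j) P_U Ux) => //=.
    by apply: regular_upd => //; apply: regD.
  by rewrite !(eq_sym _ l) (negPf li) (negPf lj).
have -> : D (P a) x = 0.
  rewrite -(pder_cst X_charts (pderU Ux) 0).
  apply: (pder_local (pderU Ux)); first exact: (polyvector_regular P_U).
  near=> y; have Uy : U y by near: y.
  by apply: (polyvector_alt (i := i) (j := j) P_U Uy) => //; near: y.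
have := polyvector_antisym Ux ra ij (regD Ux (ra i)) (ra i).
have -> : [eta [eta a with i |-> D (a i)] with j |-> a i] =
    [eta a with i |-> D (a i)] :> (_ -> _).
  by apply: funext => l /=; case: (eqVneq l j) => // ->; rewrite (negPf ji) E.
have -> : [eta [eta a with i |-> a i] with j |-> D (a i)] =
    [eta a with j |-> D (a j)] :> (_ -> _).
  by apply: funext => l /=; rewrite E; do 2!case: eqP => // ?; subst.
by move=> ->; rewrite addNr subr0.
Unshelve. all: by end_near. Qed.

Lemma lie_polyvector : polyvector U (lie P).
Proof.
move=> x Ux a ra; split.
- apply: (regular_sub X_charts).
    by apply: regD => //; apply: (polyvector_regular P_U).
  apply: (regular_sum X_charts) => j _; apply: (polyvector_regular P_U) => //.
  by apply: regular_upd => //; apply: regD.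
- move=> b ab; have NU : \forall y \near x, U y by apply: open_nbhs_nbhs.
  have Ra : \forall y \near x, forall j, regular (a j) y.
    by apply: filter_forall => l; apply: (near_regular X_charts).
  have AB : \forall z \near x, \forall y \near z, forall i, a i y = b i y.
    by apply: nbhs_interior; apply: filter_forall.
  congr (_ - _).
    apply: (pder_local (pderU Ux)); first exact: (polyvector_regular P_U).
    near=> y; have Uy : U y by near: y.
    have ray : forall j, regular (a j) y by near: y.
    have aby : \forall z \near y, forall i, a i z = b i z by near: y.
    have [_ H _ _ _] := P_U Uy ray; apply: H => i.
    by near=> z; apply: (near aby z).
  apply: eq_bigr => j _.
  have rD : forall l, regular ([eta a with j |-> D (a j)] l) x.
    by apply: regular_upd => //; apply: regD.
  have [_ H _ _ _] := P_U Ux rD; apply: H => l /=.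
  by case: eqP => // _; apply: vfield_local.
- by move=> i j ij E; apply: (lie_alt Ux ra ij E).
- by move=> i f g c rf rg; rewrite (pder_lin (lie_pder i Ux ra)).
- by move=> i f g rf rg; rewrite (pderM (lie_pder i Ux ra)).
Unshelve. all: by end_near. Qed.

End Multiderivation.

Lemma lie_eq m (P Q : op X m) a x : polyvector U P -> polyvector_eq U P Q ->
  U x -> (forall j, regular (a j) x) -> lie P a x = lie Q a x.
Proof.
move=> PU PQ Ux ra; have NU : \forall y \near x, U y by apply: open_nbhs_nbhs.
have Ra : \forall y \near x, forall j, regular (a j) y.
  by apply: filter_forall => l; apply: (near_regular X_charts).
congr (_ - _).
  apply: (pder_local (pderU Ux)); first exact: (polyvector_regular PU).
  by near=> y; apply: PQ; near: y.
apply: eq_bigr => j _; apply: PQ => //; apply: regular_upd => //.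
exact: regD.
Unshelve. all: by end_near. Qed.

Lemma big_perm_split p q (s : 'S_(p + q)) (F : 'I_(p + q) -> k) :
  \sum_j F j = \sum_(i < p) F (s (lshift q i)) + \sum_(i < q) F (s (rshift p i)).
Proof. by rewrite (reindex_inj (@perm_inj _ s)) big_split_ord. Qed.

Lemma lie_polywedge p q (P : op X p) (Q : op X q) a x : U x ->
  (forall u : 'I_p -> 'I_(p + q), regular (P (fun i => a (u i))) x) ->
  (forall u : 'I_q -> 'I_(p + q), regular (Q (fun i => a (u i))) x) ->
  lie (polywedge P Q) a x =
  \sum_(s : 'S_(p + q) |
        [forall i : 'I_p, forall j : 'I_p,
           (i < j)%N ==> (s (lshift q i) < s (lshift q j))%N] &&
        [forall i : 'I_q, forall j : 'I_q,
           (i < j)%N ==> (s (rshift p i) < s (rshift p j))%N])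
    (-1) ^+ s *
    (lie P (fun i => a (s (lshift q i))) x * Q (fun j => a (s (rshift p j))) x +
     P (fun i => a (s (lshift q i))) x * lie Q (fun j => a (s (rshift p j))) x).
Proof.
move=> Ux rP rQ; have pD := pderU Ux.
rewrite /lie {1}/polywedge (pder_sum X_charts pD); last first.
  by move=> s _; do 2!apply: (regular_mul X_charts) => //; apply: regular_cst.
rewrite /polywedge exchange_big -sumrB; apply: eq_bigr => s _ /=.
pose al := fun i => a (s (lshift q i)); pose ar := fun i => a (s (rshift p i)).
have -> : D (fun y => (-1) ^+ s * P al y * Q ar y) x =
    (-1) ^+ s * (P al x * D (Q ar) x + Q ar x * D (P al) x).
  have rPQ := regular_mul X_charts (rP (fun i => s (lshift q i)))
    (rQ (fun i => s (rshift p i))).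
  have /= <- := pderM pD (rP (fun i => s (lshift q i))) (rQ (fun i => s (rshift p i))).
  have /= <- := pderZ X_charts pD ((-1) ^+ s) rPQ.
  by congr (D _ x); apply: funext => y; rewrite mulrA.
rewrite (big_perm_split s) /= -/al -/ar.
have L i : P (fun l => [eta a with s (lshift q i) |-> D (a (s (lshift q i)))]
      (s (lshift q l))) x * Q (fun l => [eta a with s (lshift q i) |->
      D (a (s (lshift q i)))] (s (rshift p l))) x =
    P [eta al with i |-> D (al i)] x * Q ar x.
  congr (P _ x * Q _ x); apply: funext => l /=.
    by rewrite (inj_eq perm_inj) (inj_eq (@lshift_inj _ _)).
  by rewrite (inj_eq perm_inj) eq_rlshift.
have R i : P (fun l => [eta a with s (rshift p i) |-> D (a (s (rshift p i)))]
      (s (lshift q l))) x * Q (fun l => [eta a with s (rshift p i) |->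
      D (a (s (rshift p i)))] (s (rshift p l))) x =
    P al x * Q [eta ar with i |-> D (ar i)] x.
  congr (P _ x * Q _ x); apply: funext => l /=.
    by rewrite (inj_eq perm_inj) eq_lrshift.
  by rewrite (inj_eq perm_inj) (inj_eq (@rshift_inj _ _)).
under eq_bigr => i _ do rewrite -mulrA L.
under [X in _ - (_ + X)]eq_bigr => i _ do rewrite -mulrA R.
rewrite -[X in _ - (X + _)]mulr_sumr -[X in _ - (_ + X)]mulr_sumr.
rewrite -mulr_sumr -mulr_suml.
set SP := \sum_(i < p) _; set SQ := \sum_(i < q) _.
by move: ((-1) ^+ s) => c; ring.
Qed.

Lemma big_pair_ord r (s : 'S_r.*2) (F : 'I_r.*2 -> k) :
  \sum_j F j = \sum_(i < r) (F (s (pair_ord false i)) + F (s (pair_ord true i))).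
Proof.
rewrite (reindex_inj (@perm_inj _ s)).
rewrite (reindex (fun ij : 'I_r * bool => pair_ord ij.2 ij.1)) /=; last first.
  have h (j : 'I_r.*2) : (j./2 < r)%N by rewrite ltn_half_double.
  exists (fun j => (Ordinal (h j), odd j)) => [[i c] _|j _].
    by congr (_, _); [apply: val_inj; exact: pair_ord_half|exact: pair_ord_odd].
  by apply: val_inj; rewrite /= odd_double_half.
rewrite -(pair_bigA _ (fun i b => F (s (pair_ord b i)))) /=.
by apply: eq_bigr => i _; rewrite big_bool addrC.
Qed.

(** For each permutation on its own, the Leibniz rule for the product of brackets produces one term
    for each argument, and these are exactly the terms subtracted in [lie]. *)
Lemma lie_div_pow (pi : op X 2) r a x : U x ->
  (forall b c, regular b x -> regular c x -> regular (bracket pi b c) x) ->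
  (forall b c, regular b x -> regular c x ->
     D (bracket pi b c) x = bracket pi (D b) c x + bracket pi b (D c) x) ->
  (forall j, regular (a j) x) -> lie (div_pow pi r) a x = 0.
Proof.
move=> Ux rpi Dpi ra; have pD := pderU Ux.
rewrite /lie {1}/div_pow (pder_sum X_charts pD); last first.
  move=> s _; apply: (regular_mul X_charts); first exact: regular_cst.
  by apply: (regular_prod X_charts) => i _; apply: rpi.
rewrite /div_pow exchange_big -sumrB big1 // => s _ /=.
rewrite (pderZ X_charts pD); last first.
  by apply: (regular_prod X_charts) => i _; apply: rpi.
rewrite (pder_prod X_charts pD) ?index_enum_uniq //; last by move=> i; apply: rpi.
rewrite -mulr_sumr -mulrBr (big_pair_ord s) -sumrB big1 ?mulr0 // => i _.
have pair_neq (i' : 'I_r) b b' : i' != i ->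
    (s (pair_ord b' i') == s (pair_ord b i)) = false.
  move=> ii; rewrite (inj_eq perm_inj); apply: contraNF ii => /eqP.
  by move/(congr1 (fun j : 'I_r.*2 => j./2)); rewrite !pair_ord_half => /val_inj ->.
have other_neq b : (s (pair_ord b i) == s (pair_ord (~~ b) i)) = false.
  rewrite (inj_eq perm_inj); apply/eqP => /(congr1 (fun j : 'I_r.*2 => odd j)).
  by rewrite !pair_ord_odd; case: b.
rewrite Dpi // [X in _ - (X + _)](bigD1 i) //= [X in _ - (_ + X)](bigD1 i) //=.
rewrite !eqxx (other_neq false) (other_neq true) mulrDl.
set R0 := \prod_(j < r | j != i) _.
have R0E b : \prod_(i' < r | i' != i) bracket pi
    (if s (pair_ord false i') == s (pair_ord b i) then D (a (s (pair_ord b i)))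
     else a (s (pair_ord false i')))
    (if s (pair_ord true i') == s (pair_ord b i) then D (a (s (pair_ord b i)))
     else a (s (pair_ord true i'))) x = R0.
  by apply: eq_bigr => i' ii; rewrite !pair_neq.
by rewrite (R0E false) (R0E true) subrr.
Qed.

(** The determinant is differentiated factor by factor in its expansion over permutations;
    reindexing the arguments by the permutation lets the two contributions in row [i0] combine to
    the commutator of [D] and [v i0]. *)
Lemma lie_wedge_fields l (v : 'I_l -> (X -> k) -> X -> k) a x : U x ->
  (forall i f, regular f x -> regular (v i f) x) ->
  (forall j, regular (a j) x) ->
  lie (wedge_fields v) a x =
  \sum_i0 \det (\matrix_(i, j) if i == i0
     then D (v i (a j)) x - v i (D (a j)) x else v i (a j) x).
Proof.
move=> Ux rv ra; have pD := pderU Ux.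
have rva i j : regular (v i (a j)) x by apply: rv.
rewrite /lie.
have -> : D (wedge_fields v a) x = \sum_(s : 'S_l) (-1) ^+ s *
    \sum_i D (v i (a (s i))) x * \prod_(j | j != i) v j (a (s j)) x.
  rewrite -[RHS](_ : D (fun y => \sum_(s : 'S_l) (-1) ^+ s *
      \prod_i v i (a (s i)) y) x = _).
    congr (D _ x); apply: funext => y; apply: eq_bigr => s _.
    by congr (_ * _); apply: eq_bigr => i _; rewrite mxE.
  rewrite (pder_sum X_charts pD); last first.
    move=> s _; apply: (regular_mul X_charts); first exact: regular_cst.
    by apply: (regular_prod X_charts).
  apply: eq_bigr => s _; rewrite (pderZ X_charts pD); last first.
    by apply: (regular_prod X_charts).
  by rewrite (pder_prod X_charts pD) ?index_enum_uniq.
have -> : \sum_j wedge_fields v [eta a with j |-> D (a j)] x =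
    \sum_(s : 'S_l) (-1) ^+ s *
    \sum_i v i (D (a (s i))) x * \prod_(j | j != i) v j (a (s j)) x.
  rewrite exchange_big /=; apply: eq_bigr => s _.
  rewrite (reindex_inj (@perm_inj _ s)) mulr_sumr; apply: eq_bigr => i _.
  congr (_ * _); rewrite (bigD1 i) //= !mxE /= eqxx; congr (_ * _).
  by apply: eq_bigr => j ji; rewrite mxE /= (inj_eq perm_inj) (negPf ji).
rewrite -sumrB exchange_big /=; apply: eq_bigr => s _.
rewrite -mulrBr -sumrB mulr_sumr; apply: eq_bigr => i _.
rewrite -mulrBl [in RHS](bigD1 i) //= [in RHS]mxE eqxx; congr (_ * (_ * _)).
by apply: eq_bigr => j ji; rewrite mxE (negPf ji).
Qed.

End LieDerivative.

(** * Poisson Pfaffians *)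

Section PfaffianInvariance.
Variables (k : closedFieldType) (X : kspace k).
Hypothesis X_charts : has_charts X.
Hypothesis k2 : (2 : k) != 0.
Variable pi : op X 2.
Hypothesis pi_vector : polyvector setT pi.

Lemma bracket_antisym a b x : regular a x -> regular b x ->
  bracket pi a b x = - bracket pi b a x.
Proof.
move=> ra rb; have rab : regular (fun y => a y + b y) x by apply: regular_add.
have := bracket_alt pi_vector rab.
rewrite (pderD (bracket_pder_l pi_vector rab)) //.
rewrite (pderD (bracket_pder_r pi_vector ra)) // (pderD (bracket_pder_r pi_vector rb)) //.
by rewrite !bracket_alt // add0r addr0 => /eqP; rewrite addr_eq0 => /eqP.
Qed.

Variables (U : set X) (D : (X -> k) -> X -> k).
Hypothesis oU : open U.
Hypothesis D_U : vfield U D.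
Hypothesis D_pi : forall x b c, U x -> regular b x -> regular c x ->
  D (bracket pi b c) x = bracket pi (D b) c x + bracket pi b (D c) x.
Variables (r l : nat) (v : 'I_l -> (X -> k) -> X -> k).
Hypothesis r_rank : half_rank pi r.
Hypothesis v_field : forall i, vfield setT (v i).
Hypothesis D_v : forall x i, U x -> exists b, regular b x /\
  forall f, regular f x -> D (v i f) x - v i (D f) x = bracket pi b f x.

(* In coordinates at [y] adapted to [pi], each term of the shuffle sum vanishes:
   a nonzero factor [pi^[r]] uses up all non-radical coordinates, and the
   remaining ones are killed by every Hamiltonian vector field. *)
Lemma lie_pfaffian (sigma : op X (r.*2 + l)) t d (V : set X) y :
  polyvector setT sigma ->
  polyvector_eq setT sigma (polywedge (div_pow pi r) (wedge_fields v)) ->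
  coords V t d -> V y -> U y -> lie D sigma t y = 0.
Proof.
move=> sigma_vector sigmaE tV Vy Uy; have [oV rt dv dt vd] := tV.
have rty i : regular (t i) y by apply: rt.
pose n := (r.*2 + l)%N.
pose A : 'M[k]_n := \matrix_(i, j) bracket pi (t i) (t j) y.
have AT : A^T = - A by apply/matrixP => i j; rewrite !mxE bracket_antisym.
have [M [q [uM qn ME]]] := symplectic_basis k2 AT.
(* Since the coefficients are constants, every derivation acts on the [a i] through [M]; the normal
   form of their brackets is claimed at [y] only. *)
pose a i z := \sum_j M i j * t j z.
have rMt i j : regular (fun z => M i j * t j z) y.
  by apply: (regular_mul X_charts) => //; apply: regular_cst.
have ra i : regular (a i) y by apply: (regular_sum X_charts).
have va w i : pder y w -> w (a i) = \sum_j M i j * w (t j).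
  move=> pw; rewrite (pder_sum X_charts pw) //.
  by apply: eq_bigr => j _; rewrite (pderZ X_charts pw).
have aE i j : bracket pi (a i) (a j) y = hyperbolic k q i j.
  rewrite -ME (va _ _ (bracket_pder_l pi_vector (ra j))) -mulmxA !mxE.
  apply: eq_bigr => i' _; congr (_ * _).
  rewrite (va _ _ (bracket_pder_r pi_vector (rty i'))) !mxE.
  by apply: eq_bigr => j' _; rewrite !mxE mulrC.
(* At [y] the value of [pi^[q]] on the first [2 q] of the [a i] is 1, so [pi^[q]] is nonzero and the
   rank bounds [q]. *)
have qr : (q <= r)%N.
  have [_] := r_rank; apply => Z.
  have := Z y I (fun i => a (widen_ord qn i)) (fun i => ra _).
  rewrite (@div_pow_hyperbolic _ _ pi y) /zero_op => [/eqP|i j].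
    by rewrite oner_eq0.
  by rewrite aE.
(* More than the normal form, as [b] is arbitrary: [{t_i, a_j}] vanishes at [y] because every
   [{a_i, a_j}] does and [M] is invertible. *)
have radical b (j : 'I_n) : regular b y -> (q.*2 <= j)%N ->
    bracket pi b (a j) y = 0.
  move=> rb qj.
  rewrite (vd _ _ _ Vy (bracket_pder_l pi_vector (ra j)) rb) big1 // => i _.
  pose w : 'cV[k]_n := \col_i bracket pi (t i) (a j) y.
  have w0 : w = 0.
    rewrite -[w](mulKmx uM); have -> : M *m w = 0; last by rewrite mulmx0.
    apply/matrixP => i' o; rewrite !mxE.
    under eq_bigr => i'' _ do rewrite mxE.
    rewrite -(va _ _ (bracket_pder_l pi_vector (ra j))) aE /hyperbolic.
    by rewrite [(j < _)%N]ltnNge qj andbF.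
  have /matrixP/(_ i ord0) := w0; rewrite !mxE => ->.
  by rewrite mulr0.
have sU := polyvector_sub (subsetT U) sigma_vector.
have key : lie D sigma a y = 0.
  rewrite (lie_eq X_charts oU D_U sU _ Uy ra (Q := polywedge (div_pow pi r)
    (wedge_fields v))); last by move=> x Ux; apply: sigmaE.
  rewrite (lie_polywedge X_charts D_U Uy); first last.
  - move=> u; apply: (regular_det X_charts) => i j.
    under [X in regular X]funext => z do rewrite mxE.
    by case: (v_field i (x := y) I) => H _; apply: H.
  - move=> u; apply: (regular_sum X_charts) => s _; apply: (regular_mul X_charts).
      exact: regular_cst.
    by apply: (regular_prod X_charts) => i _; apply: bracket_regular.
  rewrite big1 // => s _.
  rewrite (lie_div_pow X_charts D_U Uy) ?mul0r ?add0r //; first last.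
  - by move=> b c rb rc; apply: D_pi.
  - by move=> b c; apply: bracket_regular.
  have [->|nz] := eqVneq (div_pow pi r (fun i => a (s (lshift l i))) y) 0.
    by rewrite mul0r mulr0.
  have qs := div_pow_left aE qr nz.
  rewrite (lie_wedge_fields X_charts D_U Uy) //; last first.
    by move=> i f rf; case: (v_field i (x := y) I) => H _; apply: H.
  rewrite big1 ?mulr0 // => i0 _.
  (* Row [i0] consists of the values of a Hamiltonian vector field on radical coordinates. *)
  rewrite (expand_det_row _ i0) big1 // => j _; rewrite mxE eqxx.
  have [b [rb ->]] := D_v i0 Uy; last exact: ra.
  by rewrite radical ?mul0r.
(* Passing from [a] back to [t] divides by the Jacobian determinant [\det M], which is nonzero. *)
have := polyvector_coords X_charts tV (lie_polyvector X_charts oU D_U sU) Uy Vy ra.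
rewrite key => /esym/eqP; rewrite mulf_eq0 => /orP[|/eqP //].
have -> : wedge_fields d a y = \det M.
  rewrite /wedge_fields -det_tr; congr (\det _); apply/matrixP => i j; rewrite !mxE.
  case: (dv j y Vy) => _ pd; rewrite (va _ _ pd) (bigD1 j) //= dt // eqxx mulr1.
  by rewrite big1 ?addr0 // => j' jj; rewrite dt // eq_sym (negPf jj) mulr0.
by move: uM; rewrite unitmxE unitfE => /negPf ->.
Qed.

End PfaffianInvariance.

(** * The Jacobi identity and the stability of the ideal *)

Lemma variety_charts (k : closedFieldType) (X : kspace k) :
  is_variety X -> has_charts X.
Proof.
move=> [_ [M [U [aff cover]]]] x; have [i Ux] := cover x.
have [N [c [Q cU]]] := aff i.
by exists N, (U i), c, [set v | forall q, Q q -> q.@[v] = 0].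
Qed.

(** The Schouten bracket of [pi] with itself is twice the Jacobi sum, and 2 can be cancelled. The
    identity is put in the form in which [{a, -}] is a derivation of the bracket. *)
Lemma schouten_jacobi (k : closedFieldType) (X : kspace k) (pi : op X 2) a b c x :
  has_charts X -> (2 : k) != 0 -> is_poisson pi ->
  regular a x -> regular b x -> regular c x ->
  bracket pi a (bracket pi b c) x =
  bracket pi (bracket pi a b) c x + bracket pi b (bracket pi a c) x.
Proof.
move=> X_charts k2 [piV piS] ra rb rc.
have rbr f g y : regular f y -> regular g y -> regular (bracket pi f g) y.
  exact: bracket_regular.
pose u (i : 'I_3) := nth a [:: a; b; c] i.
have ru i : regular (u i) x by case: i => [[|[|[|]]]].
have := piS x I u ru; rewrite /schouten /zero_op /u !inordK //= -!mulr2n -!mulrnDl.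
rewrite -mulr_natr => /eqP; rewrite mulf_eq0 (negPf k2) orbF => /eqP J.
have E1 : bracket pi (bracket pi b c) a x = - bracket pi a (bracket pi b c) x.
  by apply: bracket_antisym => //; apply: rbr.
have E2 : bracket pi (bracket pi c a) b x = bracket pi b (bracket pi a c) x.
  have rca := rbr c a x rc ra; rewrite bracket_antisym //.
  have pb := bracket_pder_r piV rb.
  rewrite -(pderN X_charts pb) //; apply: (pder_local pb).
    exact: (regular_opp X_charts).
  (* The antisymmetry is used inside another bracket, so it has to hold on a neighbourhood of
     [x]. *)
  have Rc := near_regular X_charts rc; have Ra := near_regular X_charts ra.
  near=> y; rewrite (bracket_antisym X_charts piV (a := c)) ?opprK //; by near: y.
move/eqP: J; rewrite E1 E2 addrAC subr_eq0 => /eqP ->.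
by [].
Unshelve. all: by end_near. Qed.

Lemma split_ideal_stable (k : closedFieldType) (p : nat) (X : kspace k) (n : nat)
    (sigma : op X n) (C : diff_form X n -> diff_form X n)
    (phi : (X -> k) -> X -> k) (Y U : set X) (D : (X -> k) -> X -> k) :
  has_charts X -> is_nonsingular X n -> p \in [pchar k] -> (2 < p)%N ->
  is_cartier p C -> defined_by p C sigma phi -> is_splitting p phi ->
  compatibly_split phi Y -> polyvector setT sigma -> open U -> vfield U D ->
  (forall V t d y, coords V t d -> V y -> U y -> lie D sigma t y = 0) ->
  forall f, ideal_of Y U f -> ideal_of Y U (D f).
Proof.
move=> X_charts X_ns p_char p_gt2 C_cartier phi_sigma [nsp phi_split] Y_split.
move=> sigma_vector oU DU D_sigma f [rf fY].
have rD g y : U y -> regular g y -> regular (D g) y.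
  by move=> Uy; case: (DU y Uy) => H _; apply: H.
split=> [y Uy|x Ux Yx]; first by apply: rD => //; apply: rf.
have [V0 [t [d [tV0 V0x]]]] := exists_coords X_charts x X_ns.
pose V := V0 `&` U; have oV : open V by apply: openI => //; apply: coords_open tV0.
have VU : V `<=` U by move=> y [].
have Vx : V x by [].
have tV : coords V t d by apply: coords_sub tV0 oV _ => y [].
have DV : vfield V D by move=> y /VU; apply: DU.
have D_sigmaV y : V y -> D (sigma t) y = \sum_i sigma [eta t with i |-> D (t i)] y.
  move=> Vy; apply/eqP; rewrite -subr_eq0; apply/eqP.
  exact: (D_sigma _ _ _ y tV Vy (VU _ Vy)).
pose w := D f; pose u y := w y ^+ p.-1.
have rwV : regular_on V w by move=> y /VU Uy; apply: rD => //; apply: rf.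
have ruV : regular_on V u by move=> y Vy; apply: (regular_exp X_charts); apply: rwV.
have rfV : regular_on V f by move=> y /VU; apply: rf.
pose g y := u y * f y; pose h y := f y * (- D u y).
have rgV : regular_on V g.
  by move=> y Vy; apply: (regular_mul X_charts); [apply: ruV|apply: rfV].
have rDuV : regular_on V (D u) by move=> y Vy; apply: rD; [apply: VU|apply: ruV].
have rhV : regular_on V h.
  move=> y Vy; apply: (regular_mul X_charts); first exact: rfV.
  by apply: (regular_opp X_charts); apply: rDuV.
have rDgV : regular_on V (D g) by move=> y Vy; apply: rD; [apply: VU|apply: rgV].
have [_ nsp_local nsp_lin] := nsp V oV.
rewrite -/w -(phi_split V w oV rwV x Vx).
(* Here [w^p = D g + h]; the factor [1 ^+ p] only gives the sum the shape of the linearity law of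
   [phi]. *)
rewrite (nsp_local _ (fun y => 1 ^+ p * D g y + h y)) //; first last.
- move=> y Vy; have [_ pD] := DV y Vy.
  rewrite (pderM pD); [|exact: ruV|exact: rfV].
  have p0 : (0 < p)%N by apply: ltn_trans p_gt2.
  by rewrite expr1n mul1r /h mulrN addrK -[in LHS](prednK p0) exprSr.
- by move=> y Vy; apply: (regular_exp X_charts); apply: rwV.
rewrite nsp_lin //; last by move=> y _; apply: regular_cst.
have sV := polyvector_sub (subsetT V) sigma_vector.
rewrite (phi_vfield X_charts tV C_cartier p_char p_gt2 phi_sigma sV DV D_sigmaV) //.
rewrite mulr0 add0r; have [|_ ->] // := Y_split V h oV.
by split=> // y Vy Yy; rewrite /h fY ?mul0r //; apply: VU.
Qed.

Theorem theoremD (k : closedFieldType) (p : nat)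
    (p_char : p \in [pchar k]) (p_gt2 : (2 < p)%N)
    (T : kspace k) (m : nat) (chi : 'I_m -> T -> k) (T_torus : is_torus chi)
    (X : kspace k) (n : nat)
    (X_var : is_variety X) (X_nonsing : is_nonsingular X n)
    (pi : op X 2) (pi_poisson : is_poisson pi)
    (act : T -> X -> X) (act_T : torus_action chi act)
    (act_poisson : acts_by_poisson act pi)
    (sigma : op X n) (sigma_pf : is_pfaffian chi act pi sigma)
    (C : diff_form X n -> diff_form X n) (C_cartier : is_cartier p C)
    (phi : (X -> k) -> X -> k) (phi_sigma : defined_by p C sigma phi)
    (phi_split : is_splitting p phi)
    (Y : set X) (Y_closed : closed Y) (Y_split : compatibly_split phi Y) :
  poisson_torus_subvariety chi act pi Y.
Proof.
have X_charts := variety_charts X_var.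
have k2 : (2 : k) != 0.
  rewrite -(dvdn_pcharf p_char); apply/negP => /(@dvdn_leq p 2 isT).
  by rewrite leqNgt p_gt2.
have [piV _] := pi_poisson.
have [sigmaV _ [r [l [h [E [r_rank sigmaE]]]]]] := sigma_pf.
subst n; have {}sigmaE : polyvector_eq setT sigma (polywedge (div_pow pi r)
    (wedge_fields (fun i => gen_field chi act (h i)))).
  move=> x _ a ra; rewrite sigmaE //; congr (polywedge _ _ _ x).
  by apply: funext => j; rewrite cast_ord_id.
have stable U D : open U -> vfield U D ->
    (forall x b c, U x -> regular b x -> regular c x ->
       D (bracket pi b c) x = bracket pi (D b) c x + bracket pi b (D c) x) ->
    (forall x i, U x -> exists b, regular b x /\ forall f, regular f x ->
       D (gen_field chi act (h i) f) x - gen_field chi act (h i) (D f) x =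
       bracket pi b f x) ->
    forall f, ideal_of Y U f -> ideal_of Y U (D f).
  move=> oU DU D_pi D_v.
  apply: (split_ideal_stable X_charts X_nonsing p_char p_gt2 C_cartier phi_sigma
    phi_split Y_split sigmaV oU DU) => V t d y tV Vy Uy.
  apply: (lie_pfaffian X_charts k2 piV oU DU D_pi r_rank _ D_v sigmaV sigmaE tV Vy Uy).
  by move=> i; apply: gen_field_vfield.
split=> // [U a f oU ra|e U f oU].
- apply: stable => // [x Ux|x b c Ux rb rc|x i Ux].
  + split=> [g rg|]; last by apply: (bracket_pder_r piV); apply: ra.
    by apply: (bracket_regular piV) => //; apply: ra.
  + by apply: schouten_jacobi => //; apply: ra.
  have rax := ra x Ux; pose dh := gen_field chi act (h i).
  have rdh g : regular g x -> regular (dh g) x.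
    have [H _] := gen_field_vfield T_torus X_charts act_T (h i) (U := setT) (x := x) I.
    exact: H.
  exists (fun z => - dh a z); split=> [|g rg].
    by apply: (regular_opp X_charts); apply: rdh.
  rewrite (pderN X_charts (bracket_pder_l piV rg)); last exact: rdh.
  rewrite gen_field_bracket // opprD addrCA.
  by rewrite subrr addr0.
- apply: stable => // [|x b c Ux rb rc|x i Ux].
  + exact: gen_field_vfield.
  + exact: gen_field_bracket.
  (* The generators commute, so their commutator is the Hamiltonian vector field of 0. *)
  exists (fun=> 0); split=> [|g rg]; first exact: regular_cst.
  rewrite (pder_cst X_charts (bracket_pder_l piV rg)).
  by rewrite (gen_field_comm T_torus X_charts act_T e (h i)) // subrr.
Qed.
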